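(* Let $\lambda\in\overline{\mathrm{Pr}}_k$. Then the simple highest weight module $L^{\mathfrak g}_{\mathfrak b}(\lambda)$ (with respect to the standard Borel subalgebra $\mathfrak b$) is a strongly tame $\Gamma_{\rm st}$-Gelfand–Tsetlin $\mathfrak g$-module. Moreover, for every $u\in\overline W$, the module $L^{\mathfrak g}_{u(\mathfrak b)}(u(\lambda))$ is a strongly tame $\Gamma_{\rm st}(u(\Pi_{\rm st}))$-Gelfand–Tsetlin $\mathfrak g$-module.
   Context: Let $\mathfrak g=\mathfrak{sl}_{n+1}(\mathbb C)$, $n\ge1$, $E_{i,j}$ matrix units, $\mathfrak h$ the traceless diagonal matrices, $\Delta_+=\{\varepsilon_i-\varepsilon_j:i<j\}$, $\Delta_-=-\Delta_+$, $\Pi_{\rm st}=(\alpha_1,\dots,\alpha_n)$, $\alpha_i=\varepsilon_i-\varepsilon_{i+1}$, $\mathfrak b$ the upper triangular Borel; $e_i=E_{i,i+1},f_i=E_{i+1,i},h_i=E_{ii}-E_{i+1,i+1}$. $(\cdot,\cdot)$ invariant form on $\mathfrak h^*$ with $(\alpha,\alpha)=2$ for roots; $\omega_i$ fundamental weights, $P^\vee=\bigoplus\mathbb Z\omega_i$, $\rho=\sum\omega_i$; $W$ the Weyl group, $w\cdot\mu=w(\mu+\rho)-\rho$. Admissible weights: fix $k\in\mathbb Q$, $k+n+1=p/q$, $p,q\in\mathbb N$ coprime, $p\ge n+1$; $\overline{\mathrm{Pr}}_{k,\mathbb Z}=\{\sum\lambda_i\omega_i:\lambda_i\in\mathbb N_0,\sum\lambda_i\le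 p-n-1\}$; for $w\in W$, $\eta\in P^\vee$, $C(w,\eta)$ means: for all $\alpha\in\Delta_+$, $0\le(\eta,\alpha)\le q-1$ if $w(\alpha)\in\Delta_+$, $1\le(\eta,\alpha)\le q$ if $w(\alpha)\in\Delta_-$; $\overline{\mathrm{Pr}}_k=\{w\cdot(\mu-\tfrac pq\eta):\mu\in\overline{\mathrm{Pr}}_{k,\mathbb Z},w\in W,\eta\in P^\vee,C(w,\eta)\}$. $\overline W\subset\mathrm{Aut}(\mathfrak g)$ is the group generated by $r_i=\exp(\mathrm{ad}f_i)\exp(-\mathrm{ad}e_i)\exp(\mathrm{ad}f_i)$ ($i=1,\dots,n$) and the involution $\sigma$ with $\sigma(e_i)=e_{n+1-i}$, $\sigma(f_i)=f_{n+1-i}$, $\sigma(h_i)=-h_{n+1-i}$. Elements of $\overline W$ preserve $\mathfrak h$ and so act on $\mathfrak h^*$, on roots, on bases (ordered sets of simple roots) and on Borel subalgebras containing $\mathfrak h$. For $u\in\overline W$ and a $\mathfrak g$-module $M$, $M^u$ is $M$ with action $a\cdot v=u^{-1}(a)v$. For a Borel $\mathfrak b'\supset\mathfrak h$, $L^{\mathfrak g}_{\mathfrak b'}(\mu)$ is the simple highest weight module of highest weight $\mu$ with respect to $\mathfrak b'$. A $\mathfrak g$-module $M$ is a strongly tame $\Gamma_{\rm st}$-Gelfand–Tsetlin module if it has a basis $\{T(v):v\in S\}$ indexed by a set $S$ of arrays $v=(v_{j,i})_{1\le i\le j\le n+1}$ of complex numbers such that for $k=1,\dots,n$: $e_k T(v)=-\sum_{i=1}^k\frac{\prod_{j=1}^{k+1}(v_{k,i}-v_{k+1,j})}{\prod_{j\ne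 i}(v_{k,i}-v_{k,j})}T(v+\delta^{k,i})$, $f_kT(v)=\sum_{i=1}^k\frac{\prod_{j=1}^{k-1}(v_{k,i}-v_{k-1,j})}{\prod_{j\ne i}(v_{k,i}-v_{k,j})}T(v-\delta^{k,i})$, $h_kT(v)=\big(2\sum_{i=1}^kv_{k,i}-\sum_{i=1}^{k-1}v_{k-1,i}-\sum_{i=1}^{k+1}v_{k+1,i}-1\big)T(v)$, where $\delta^{k,i}$ is the array with $1$ at position $(k,i)$ and $0$ elsewhere, summands with vanishing denominator are zero, and $T(w)$ for $w\notin S$ means $0$ (such a basis is an eigenbasis for the standard Gelfand–Tsetlin subalgebra $\Gamma_{\rm st}$ generated by the centers of $U(\mathfrak{gl}_m)$, $m\le n+1$). For a base $\Pi'$, $M$ is a strongly tame $\Gamma_{\rm st}(\Pi')$-Gelfand–Tsetlin module if there is $u\in\overline W$ with $\Pi'=u(\Pi_{\rm st})$ (as ordered sets) such that $M^{u^{-1}}$ is a strongly tame $\Gamma_{\rm st}$-Gelfand–Tsetlin module.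
   Formalization: The stated σ cannot be a Lie algebra automorphism, since σ(h_i)=[σ(e_i),σ(f_i)]=h_{n+1-i}, not -h_{n+1-i}; here σ is the diagram automorphism with σ(e_i)=e_{n+1-i}, σ(f_i)=f_{n+1-i}, and so σ(h_i)=h_{n+1-i}. *)

(* Defs.v *)
(* g = sl_{n+1}(C) with C = R[i], R : realType (i.e. C is the
   field of complex numbers).  Elements of g are the traceless matrices in
   'M[C]_(n.+1).  All indices of the paper (1-based) are kept 1-based where
   the paper's formulas are transcribed (matrix units, GT arrays); weights are
   handled in epsilon-coordinates indexed by 'I_(n.+1) (0-based). *)
From HB Require Import structures.
From mathcomp Require Import all_boot all_order all_algebra all_fingroup.
From mathcomp Require Import reals complex.
Set Implicit Arguments.
Unset Strict Implicit.
Unset Printing Implicit Defensive.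
Import Order.TTheory GRing.Theory Num.Theory.
Local Open Scope ring_scope.

Section Sl.
Variable R : realType.
Local Notation C := R[i].
Variable n : nat.
Local Notation M := 'M[C]_(n.+1).

Definition sl (x : M) : Prop := \tr x = 0.
Definition cartan (x : M) : Prop := is_diag_mx x /\ \tr x = 0.
Definition nplus (x : M) : Prop := forall i j : 'I_n.+1, (j <= i)%N -> x i j = 0.

(* matrix unit E_{a,b}, 1-based indices *)
Definition Eu (a b : nat) : M :=
  \matrix_(i, j) (((i : nat) == a.-1) && ((j : nat) == b.-1))%:R.
Definition gt_e (k : nat) : M := Eu k k.+1.
Definition gt_f (k : nat) : M := Eu k.+1 k.
Definition gt_h (k : nat) : M := Eu k k - Eu k.+1 k.+1.

Definition lie (x y : M) : M := x *m y - y *m x.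

(* exp(ad x) for a nilpotent matrix x (x^(n+1) = 0 implies (ad x)^(2n+1) = 0,
   so the exponential series is this finite sum); used for x = +-e_i, +-f_i. *)
Definition expad (x : M) (y : M) : M :=
  \sum_(m < (2 * n).+2) (m`!%:R)^-1 *: iter m (lie x) y.

Definition rW (k : nat) : M -> M :=
  expad (gt_f k) \o expad (- gt_e k) \o expad (gt_f k).
Definition rWinv (k : nat) : M -> M :=
  expad (- gt_f k) \o expad (gt_e k) \o expad (- gt_f k).

(* sigma : the involution with sigma(e_i) = e_{n+1-i}, sigma(f_i) = f_{n+1-i}:
   sigma(x) = - J x^T J^T with J the signed antidiagonal matrix
   J_{a,n+2-a} = (-1)^a (1-based). *)
Definition Jmx : M :=
  \matrix_(a, b) (if ((a : nat) + b == n)%N then (-1) ^+ (a : nat).+1 else 0).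
Definition sigmaW (x : M) : M := - (Jmx *m x^T *m Jmx^T).

(* The group \overline W, generated by the r_i (1 <= i <= n) and sigma.
   Wbar u ui : u is an element of \overline W and ui is its inverse. *)
Inductive Wbar : (M -> M) -> (M -> M) -> Prop :=
| Wbar_id : Wbar id id
| Wbar_r : forall u ui k, (1 <= k <= n)%N -> Wbar u ui ->
    Wbar (u \o rW k) (rWinv k \o ui)
| Wbar_rinv : forall u ui k, (1 <= k <= n)%N -> Wbar u ui ->
    Wbar (u \o rWinv k) (rW k \o ui)
| Wbar_sigma : forall u ui, Wbar u ui -> Wbar (u \o sigmaW) (sigmaW \o ui).

(* simple root alpha_k (1-based) as a functional on h *)
Definition alpha (k : nat) (x : M) : C :=
  \sum_(a < n.+1 | (a : nat) == k.-1) x a a - \sum_(a < n.+1 | (a : nat) == k) x a a.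

(* u(Pi_st) = u'(Pi_st) as ordered sets: u(alpha_k) = u'(alpha_k) for all k,
   where u(alpha) = alpha o u^{-1} on h. *)
Definition same_base (ui ui' : M -> M) : Prop :=
  forall k, (1 <= k <= n)%N -> forall x, cartan x -> alpha k (ui x) = alpha k (ui' x).

Section Modules.
Variable V : lmodType C.
Variable rho : M -> V -> V.

Definition is_gmod : Prop :=
  [/\ (forall x (a : C) (v w : V), rho x (a *: v + w) = a *: rho x v + rho x w),
      (forall x y (a : C) (v : V), sl x -> sl y ->
          rho (a *: x + y) v = a *: rho x v + rho y v) &
      (forall x y (v : V), sl x -> sl y ->
          rho (lie x y) v = rho x (rho y v) - rho y (rho x v))].

Definition submodule (U : V -> Prop) : Prop :=
  [/\ U 0, (forall v w, U v -> U w -> U (v + w)),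
      (forall (a : C) v, U v -> U (a *: v)) &
      (forall x v, sl x -> U v -> U (rho x v))].

Definition simple_gmod : Prop :=
  (exists v : V, v <> 0) /\
  forall U, submodule U -> (forall v, U v -> v = 0) \/ (forall v, U v).

(* v is a highest weight vector of weight u(lam) for the Borel u(b)
   (u(lam) = lam o u^{-1} on h, u(b) = u(h + n_+)). *)
Definition hw_vector (u : M -> M) (lam : M -> C) (v : V) : Prop :=
  [/\ v <> 0,
      (forall x, cartan x -> rho (u x) v = lam x *: v) &
      (forall x, nplus x -> rho (u x) v = 0)].

(* an array v = (v_{j,i}), 1 <= i <= j <= n+1, entry v j i (1-based);
   entries outside the triangle are required to be 0. *)
Definition arr := nat -> nat -> C.
Definition delta (k i : nat) : arr := fun j l => ((j == k) && (l == i))%:R.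
Definition arr_add (v w : arr) : arr := fun j l => v j l + w j l.
Definition arr_sub (v w : arr) : arr := fun j l => v j l - w j l.

Definition coef_e (v : arr) (k i : nat) : C :=
  let num := \prod_(1 <= j < k.+2) (v k i - v k.+1 j) in
  let den := \prod_(1 <= j < k.+1 | j != i) (v k i - v k j) in
  if den == 0 then 0 else num / den.
Definition coef_f (v : arr) (k i : nat) : C :=
  let num := \prod_(1 <= j < k) (v k i - v k.-1 j) in
  let den := \prod_(1 <= j < k.+1 | j != i) (v k i - v k j) in
  if den == 0 then 0 else num / den.
Definition coef_h (v : arr) (k : nat) : C :=
  2 * (\sum_(1 <= i < k.+1) v k i) - (\sum_(1 <= i < k) v k.-1 i)
    - (\sum_(1 <= i < k.+2) v k.+1 i) - 1.

Definition strongly_tame_GT : Prop :=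
  exists (S : arr -> Prop) (T : arr -> V),
  [/\ (forall w, S w -> forall j i, ~~ [&& 1 <= i, i <= j & j <= n.+1]%N -> w j i = 0),
      (forall w, ~ S w -> T w = 0),
      (forall m (w : 'I_m -> arr) (c : 'I_m -> C), injective w ->
          (forall l, S (w l)) -> \sum_(l < m) c l *: T (w l) = 0 ->
          forall l, c l = 0),
      (forall x : V, exists m (w : 'I_m -> arr) (c : 'I_m -> C),
          (forall l, S (w l)) /\ x = \sum_(l < m) c l *: T (w l)) &
      (forall k, (1 <= k <= n)%N -> forall v, S v ->
        [/\ rho (gt_e k) (T v) =
              - \sum_(1 <= i < k.+1) coef_e v k i *: T (arr_add v (delta k i)),
            rho (gt_f k) (T v) =
              \sum_(1 <= i < k.+1) coef_f v k i *: T (arr_sub v (delta k i)) &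
            rho (gt_h k) (T v) = coef_h v k *: T v])].
End Modules.

(* M^{w} : the module M twisted by w (a . v = w^{-1}(a) v); for w = u^{-1}
   the twisted action is a . v = u(a) v. *)
Definition twist_by_inv (V : lmodType C) (rho : M -> V -> V) (u : M -> M) : M -> V -> V :=
  fun x => rho (u x).

Definition strongly_tame_GT_base (V : lmodType C) (rho : M -> V -> V)
    (ui : M -> M) : Prop :=
  exists u' ui', [/\ Wbar u' ui', same_base ui ui' &
                    strongly_tame_GT (twist_by_inv rho u')].

(* weights in epsilon-coordinates c : 'I_(n+1) -> C, i.e. sum_a c_a eps_a;
   its value on x in h is sum_a c_a x_{aa}. *)
Definition wt_val (c : 'I_n.+1 -> C) (x : M) : C := \sum_a c a * x a a.
(* sum_i c_i omega_{i+1}  (i : 'I_n)  in epsilon-coordinates *)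
Definition epsc (c : 'I_n -> C) : 'I_n.+1 -> C :=
  fun a => \sum_(i < n | (a <= i)%N) c i.
Definition rho_eps : 'I_n.+1 -> C := fun a => (n - a)%:R.
(* Weyl group W = S_{n+1} permuting the eps_a *)
Definition wact (w : 'S_n.+1) (c : 'I_n.+1 -> C) : 'I_n.+1 -> C :=
  fun b => c ((w^-1)%g b).
Definition dot_act (w : 'S_n.+1) (c : 'I_n.+1 -> C) : 'I_n.+1 -> C :=
  fun b => wact w (fun a => c a + rho_eps a) b - rho_eps b.

(* condition C(w, eta); positive roots eps_a - eps_b with a < b, and
   (eta, eps_a - eps_b) = sum_{a <= i < b} eta_i *)
Definition Ccond (q : nat) (w : 'S_n.+1) (eta : 'I_n -> int) : Prop :=
  forall a b : 'I_n.+1, (a < b)%N ->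
    let s := \sum_(i < n | (a <= i < b)%N) eta i in
    if (w a < w b)%N then (0 <= s) /\ (s <= (q.-1)%:Z)
    else (1 <= s) /\ (s <= q%:Z).

(* lam in \overline{Pr}_k, k + n + 1 = p/q *)
Definition in_Prbar (p q : nat) (lam : M -> C) : Prop :=
  exists (mu : 'I_n -> nat) (w : 'S_n.+1) (eta : 'I_n -> int),
  [/\ (\sum_i mu i <= p - n.+1)%N,
      Ccond q w eta &
      forall x, cartan x ->
        lam x = wt_val (dot_act w (fun a => epsc (fun i => (mu i)%:R) a
                         - (p%:R / q%:R) * epsc (fun i => (eta i)%:~R) a)) x].

End Sl.

(* Main.v *)
(* Write a = lam + rho in epsilon-coordinates. Admissibility implies that, for i < j,
   a_j - a_i is never a natural number. Let S be the set of arrays with top row a,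
   v_{k+1,i} - v_{k,i} in N, and v_{k+1,j} - v_{k,i} not in N for i < j. On coordinate functions
   on S the Gelfand-Tsetlin formulas satisfy [e_k, f_l] = delta_{kl} h_k: the off-diagonal part
   is an identity of coefficients, the diagonal part a residue computation in which every
   coalescing pair of poles is cancelled by zeros. The Serre relations are not needed: in the
   product of L(lam) with this module the submodule generated by the pair of highest weight
   vectors is spanned by f-monomials, so its lam-weight space is a line, and it is the graph of
   an isomorphism as soon as both factors are simple. On the Gelfand-Tsetlin side simplicity
   follows by comparing consecutive rows: a vector killed by e_1, ..., e_k is supported on
   arrays whose first k+1 rows are aligned, and dually every basis vector is reached by
   lowering operators from the array all of whose rows are truncations of a. Twisting by
   elements of \overline W, which act as Lie algebra automorphisms, gives the second claim. *)
Require Import Defs.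
From HB Require Import structures.
From mathcomp Require Import all_boot all_order all_algebra all_fingroup.
From mathcomp Require Import reals complex boolp functions.
From mathcomp Require Import zify ring.
Set Implicit Arguments.
Unset Strict Implicit.
Unset Printing Implicit Defensive.
Import Order.TTheory GRing.Theory Num.Theory.
Local Open Scope ring_scope.

(** * Sums of residues *)

Lemma sum_horner_div_prod (F : fieldType) (xs : seq F) (f : {poly F}) :
  uniq xs -> (size f <= size xs)%N ->
  \sum_(x <- xs) f.[x] / \prod_(y <- xs | y != x) (x - y) = f`_(size xs).-1.
Proof.
move=> xs_uniq f_size.
pose L x : {poly F} := \prod_(y <- xs | y != x) ('X - y%:P).
have LE x z : (L x).[z] = \prod_(y <- xs | y != x) (z - y).
  by rewrite horner_prod; apply: eq_bigr => y _; rewrite hornerXsubC.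
have L_size x : x \in xs -> size (L x) = size xs.
  move=> x_xs; rewrite /L -big_filter -rem_filter // size_prod_XsubC size_rem //.
  by rewrite prednK //; case: (xs) x_xs.
have L_diag x : (L x).[x] != 0.
  by rewrite LE prodf_seq_neq0; apply/allP => y _; rewrite subr_eq0 eq_sym implybb.
have interpolation : f = \sum_(x <- xs) (f.[x] / (L x).[x]) *: L x.
  apply/eqP; rewrite -subr_eq0; apply/eqP.
  apply: (@roots_geq_poly_eq0 _ _ xs) => //.
    apply/allP => z z_xs; rewrite /root hornerD hornerN subr_eq0 horner_sum.
    rewrite (bigD1_seq z) //= hornerZ divfK ?L_diag // big1 ?addr0 // => x xz.
    rewrite hornerZ (LE x z) -big_filter (big_rem z) ?mem_filter ?z_xs 1?eq_sym ?xz //=.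
    by rewrite subrr mul0r mulr0.
  apply: leq_trans (size_polyD _ _) _; rewrite geq_max size_polyN f_size big_seq.
  apply: leq_trans (size_sum _ _ _) _; apply/bigmax_leqP_seq => x x_xs _.
  by apply: leq_trans (size_scale_leq _ _) _; rewrite L_size.
rewrite [in RHS]interpolation coef_sum big_seq [RHS]big_seq.
apply: eq_bigr => x x_xs; rewrite coefZ -(L_size x x_xs) -lead_coefE.
by rewrite (monicP (monic_prod_XsubC _ _ _)) mulr1 LE.
Qed.

Lemma size_subr_prod_XsubC (F : idomainType) (xs ys : seq F) : size xs = size ys ->
  (size (\prod_(x <- xs) ('X - x%:P) - \prod_(y <- ys) ('X - y%:P))%R <= size xs)%N.
Proof.
move=> xs_ys; apply/leq_sizeP => j; rewrite leq_eqVlt => /predU1P[<-|xs_j].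
  have lead zs : (\prod_(z <- zs) ('X - z%:P) : {poly F})`_(size zs) = 1.
    by rewrite -[RHS](monicP (monic_prod_XsubC zs predT idfun)) lead_coefE size_prod_XsubC.
  by rewrite coefB lead xs_ys lead subrr.
by rewrite coefB !nth_default ?subrr // size_prod_XsubC -?xs_ys.
Qed.

(* Residue theorem for \prod_t (X - s t) / \prod_t (X - r t), whose residue at infinity is
   \sum_t (s t - r t). *)
Lemma residue_sum_simple (F : fieldType) (T : finType) (A : pred T)
    (r s : T -> F) : {in A &, injective r} ->
  \sum_(t | A t) (\prod_(t' | A t') (r t - s t'))
      / (\prod_(t' | A t' && (t' != t)) (r t - r t'))
  = \sum_(t | A t) (r t - s t).
Proof.
move=> r_inj; have [t0 At0|A0] := pickP A; last by rewrite !big_pred0.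
pose xs := [seq r t | t <- enum A]; pose ys := [seq s t | t <- enum A].
pose f : {poly F} := \prod_(y <- ys) ('X - y%:P) - \prod_(x <- xs) ('X - x%:P).
have xs_ys : size ys = size xs by rewrite !size_map.
have xs_uniq : uniq xs.
  by rewrite map_inj_in_uniq ?enum_uniq // => t t'; rewrite !mem_enum; apply: r_inj.
have xs_neq0 : size xs != 0%N.
  by rewrite size_map -cardE -lt0n; apply/card_gt0P; exists t0.
have horner_xs (u : T -> F) z :
    (\prod_(y <- [seq u t | t <- enum A]) ('X - y%:P)).[z] = \prod_(t | A t) (z - u t).
  rewrite horner_prod big_map big_enum; apply: eq_bigr => t _.
  by rewrite hornerXsubC.
have f_size : (size f <= size xs)%N by rewrite -xs_ys size_subr_prod_XsubC.
have f_coef : f`_(size xs).-1 = \sum_(t | A t) (r t - s t).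
  rewrite coefB -{1}xs_ys !coefPn_prod_XsubC ?xs_ys // opprK addrC sumrB.
  by rewrite !big_map !big_enum.
rewrite -f_coef -(sum_horner_div_prod xs_uniq f_size) big_map big_enum.
apply: eq_bigr => t At; congr (_ / _).
  by rewrite hornerD hornerN !horner_xs [X in _ - X](bigD1 t) //= subrr mul0r subr0.
rewrite big_map big_enum_cond; apply: eq_bigl => t' /=; rewrite -[A t']/(t' \in A).
by have [At'|//] := boolP (t' \in A); rewrite (inj_in_eq r_inj).
Qed.

(* Coinciding poles are harmless as long as each of them meets its own zero: such
   factors cancel, and the corresponding summands have numerator 0. *)
Lemma residue_sum (F : fieldType) (T : finType) (r s : T -> F) :
  (forall t t', t != t' -> r t = r t' -> r t = s t) ->
  \sum_t (\prod_t' (r t - s t')) / (\prod_(t' | t' != t) (r t - r t'))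
  = \sum_t (r t - s t).
Proof.
move=> coalesce; pose A t := r t != s t.
have cancelled t : ~~ A t -> r t = s t by rewrite negbK => /eqP.
rewrite [RHS](bigID A) [LHS](bigID A) /= [X in _ + X]big1 ?addr0; last first.
  by move=> t /cancelled e; rewrite (bigD1 t) //= e subrr !mul0r.
rewrite [X in _ = _ + X]big1 ?addr0; last by move=> t /cancelled ->; rewrite subrr.
rewrite -residue_sum_simple; last first.
  move=> t t' At At' rtt'; apply/eqP/negPn/negP => tt'.
  by move/eqP: At; apply; apply: coalesce rtt'.
apply: eq_bigr => t At; rewrite [X in X / _](bigID A) /= [X in _ / X](bigID A) /=.
set Z := \prod_(t' | ~~ A t') _.
have Z_neq0 : Z != 0.
  apply/prodf_neq0 => t' NAt'; rewrite subr_eq0 -(cancelled _ NAt').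
  apply: contraNneq (At) => rtt'; apply/eqP/(coalesce t t') => //.
  by apply: contraNneq NAt' => <-.
have -> : \prod_(t' | (t' != t) && ~~ A t') (r t - r t') = Z.
  apply: eq_big => [t'|t' /andP[_ /cancelled -> //]].
  by case: eqVneq => // ->; rewrite At.
rewrite -mulf_div divff // mulr1; congr (_ / _).
by apply: eq_bigl => t'; rewrite andbC.
Qed.

Definition gt_ratio (F : fieldType) (k b i : nat) (r s : nat -> F) (c : F) : F :=
  (\prod_(1 <= j < b) (c - s j)) / \prod_(1 <= j < k.+1 | j != i) (c - r j).

Section GTResidues.
Variables (F : fieldType) (k : nat) (x y z : nat -> F).
Implicit Types (t : 'I_k.+1 + 'I_k.+1) (c : F).

(* The diagonal part of [e_k, f_k] is a sum of residues of
   \prod_j (X - z_j) \prod_j (X - 1 - y_j) / \prod_j (X - x_j) (X - 1 - x_j),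
   where z, x, y are consecutive rows of lengths k, k+1 and k+2. Zeros are indexed like the
   poles, so that each of two coalescing poles meets the zero of its own index. *)
Definition gt_pole t : F :=
  match t with inl i => x i.+1 | inr i => x i.+1 + 1 end.

Definition gt_zero t : F :=
  match t with
  | inl i => if (i < k)%N then z i.+1 else y k.+2 + 1
  | inr i => y i.+1 + 1
  end.

Hypothesis x_inj : forall i l,
  (1 <= i <= k.+1)%N -> (1 <= l <= k.+1)%N -> x i = x l -> i = l.
Hypothesis x_succ : forall i l, (1 <= i <= k.+1)%N -> (1 <= l <= k.+1)%N ->
  x i = x l + 1 -> [/\ (i < k.+1)%N, x i = z i & x l = y l].

Lemma gt_pole_coalesce t t' : t != t' -> gt_pole t = gt_pole t' -> gt_pole t = gt_zero t.
Proof.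
have range (i : 'I_k.+1) : (1 <= i.+1 <= k.+1)%N by rewrite ltn_ord.
case: t t' => [i|i] [j|j] /= ij xij.
- by case/negP: ij; apply/eqP; congr inl; apply/ord_inj/succn_inj/x_inj.
- by have [ik -> _] := x_succ (range i) (range j) xij; move: ik; rewrite ltnS => ->.
- by have [_ _ ->] := x_succ (range j) (range i) (esym xij).
- case/negP: ij; apply/eqP; congr inr; apply/ord_inj/succn_inj/x_inj => //.
  exact: addIr xij.
Qed.

Lemma sum_gt_pole_zero : \sum_t (gt_pole t - gt_zero t) =
  2 * (\sum_(1 <= i < k.+2) x i) - (\sum_(1 <= i < k.+1) z i)
    - (\sum_(1 <= i < k.+3) y i) - 1.
Proof.
rewrite big_sumType /= !big_add1 /= !big_mkord !sumrB.
rewrite [\sum_(i < k.+1) (if _ then _ else _)]big_ord_recr /= ltnn.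
under [\sum_(i < k) (if _ then _ else _)]eq_bigr => i _ do rewrite ltn_ord.
rewrite [\sum_(i < k.+2) _]big_ord_recr /= [\sum_(i < k.+1) (_ + 1)]big_split /=.
by rewrite [\sum_(i < k.+1) (y _ + 1)]big_split /=; ring.
Qed.

Lemma prod_gt_zero c : \prod_t (c - gt_zero t) =
  (\prod_(1 <= j < k.+1) (c - z j)) * \prod_(1 <= j < k.+3) (c - 1 - y j).
Proof.
rewrite big_sumType /= big_ord_recr /= ltnn -mulrA; congr (_ * _).
  by rewrite big_add1 big_mkord; apply: eq_bigr => j _; rewrite ltn_ord.
rewrite big_add1 big_mkord [RHS]big_ord_recr /= mulrC opprD addrA addrAC.
by congr (_ * _); apply: eq_bigr => j _; rewrite opprD addrA addrAC.
Qed.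

Lemma prod_ord_neq c (i : 'I_k.+1) : \prod_(j < k.+1 | j != i) (c - x j.+1) =
  \prod_(1 <= j < k.+2 | j != i.+1) (c - x j).
Proof. by rewrite big_add1 big_mkord; apply: eq_bigl => j; rewrite eqSS. Qed.

Lemma prod_ord_neq_succ c (i : 'I_k.+1) : \prod_(j < k.+1 | j != i) (c - (x j.+1 + 1)) =
  \prod_(1 <= j < k.+2 | j != i.+1) (c - 1 - x j).
Proof. by rewrite -prod_ord_neq; apply: eq_bigr => j _; rewrite opprD addrA addrAC. Qed.

Lemma prod_gt_pole_inl (i : 'I_k.+1) : \prod_(t | t != inl i) (x i.+1 - gt_pole t) =
  - ((\prod_(1 <= j < k.+2 | j != i.+1) (x i.+1 - x j)) *
     \prod_(1 <= j < k.+2 | j != i.+1) (x i.+1 - 1 - x j)).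
Proof.
rewrite big_sumType /= [X in _ * X](bigD1 i) //= opprD addrA subrr sub0r mulN1r mulrN.
congr (- (_ * _)); first exact: prod_ord_neq.
exact: prod_ord_neq_succ.
Qed.

Lemma prod_gt_pole_inr (i : 'I_k.+1) : \prod_(t | t != inr i) (x i.+1 + 1 - gt_pole t) =
  (\prod_(1 <= j < k.+2 | j != i.+1) (x i.+1 + 1 - x j)) *
    \prod_(1 <= j < k.+2 | j != i.+1) (x i.+1 - x j).
Proof.
rewrite big_sumType /= [X in X * _](bigD1 i) //= addrAC subrr add0r mul1r.
congr (_ * _); first exact: prod_ord_neq.
by rewrite -[in RHS](addrK 1 (x i.+1)); apply: prod_ord_neq_succ.
Qed.

Lemma sum_gt_residue :
  \sum_(1 <= i < k.+2)
    (gt_ratio k.+1 k.+1 i x z (x i + 1) * gt_ratio k.+1 k.+3 i x y (x i)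
     - gt_ratio k.+1 k.+3 i x y (x i - 1) * gt_ratio k.+1 k.+1 i x z (x i))
  = 2 * (\sum_(1 <= i < k.+2) x i) - (\sum_(1 <= i < k.+1) z i)
    - (\sum_(1 <= i < k.+3) y i) - 1.
Proof.
rewrite -sum_gt_pole_zero -(residue_sum gt_pole_coalesce) big_sumType /=.
rewrite big_add1 /= big_mkord addrC -big_split /=; apply: eq_bigr => i _.
rewrite prod_gt_pole_inl prod_gt_pole_inr !prod_gt_zero addrK invrN !invfM /gt_ratio.
by ring.
Qed.

End GTResidues.

(** * Gelfand-Tsetlin coefficients *)

Lemma big_natD1 (T : Type) (idx : T) (op : Monoid.com_law idx) (P : pred nat)
    (F : nat -> T) (a b i : nat) : (a <= i < b)%N -> P i ->
  \big[op/idx]_(a <= j < b | P j) F j =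
  op (F i) (\big[op/idx]_(a <= j < b | P j && (j != i)) F j).
Proof.
move=> iab Pi; rewrite -big_filter (bigD1_seq i) ?filter_uniq ?iota_uniq //=.
  by rewrite big_filter_cond.
by rewrite mem_filter Pi mem_index_iota.
Qed.

Section GTRatio.
Variables (F : fieldType) (k b i : nat).
Implicit Types (r s : nat -> F) (c : F) (j : nat).

Lemma gt_ratio_eq0 r s c j : (1 <= j < b)%N -> c = s j -> gt_ratio k b i r s c = 0.
Proof.
move=> jb csj; rewrite /gt_ratio (big_natD1 _ (P := predT) _ jb) //=.
by rewrite csj subrr !mul0r.
Qed.

Lemma gt_ratio_neq0 r s c : (forall j, (1 <= j < b)%N -> c <> s j) ->
  (forall j, (1 <= j <= k)%N -> c = r j -> j = i) -> gt_ratio k b i r s c != 0.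
Proof.
move=> cs cr; rewrite mulf_neq0 ?invr_eq0 // prodf_seq_neq0; apply/allP => j;
  rewrite mem_index_iota => jk; apply/implyP => ji; rewrite subr_eq0.
  exact/eqP/cs.
by apply: contraNneq ji => /cr ->.
Qed.

Lemma eq_gt_ratio r r' s s' c : {in predC1 i, r =1 r'} -> s =1 s' ->
  gt_ratio k b i r s c = gt_ratio k b i r' s' c.
Proof.
move=> rr' ss'; congr (_ / _); apply: eq_bigr => j; first by rewrite ss'.
by move=> /rr' ->.
Qed.

(* Comparing two values through a common factor d, instead of dividing one by the other,
   avoids having to exclude zeros and poles. *)
Lemma gt_ratio_den_factor r r' s s' c j : (1 <= j <= k)%N -> j != i ->
  {in predC1 j, r =1 r'} -> s =1 s' ->
  exists d, gt_ratio k b i r s c = d / (c - r j) /\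
            gt_ratio k b i r' s' c = d / (c - r' j).
Proof.
move=> jk ji rr' /funext <-; exists ((\prod_(1 <= m < b) (c - s m))
  / \prod_(1 <= m < k.+1 | (m != i) && (m != j)) (c - r m)).
rewrite /gt_ratio !(big_natD1 _ (P := fun m => m != i) _ (i := j)) //=.
rewrite (eq_bigr (fun m => c - r m) (F1 := fun m => c - r' m)) => [|m /andP[_ /rr' -> //]].
by split; rewrite invfM mulrA mulrAC.
Qed.

Lemma gt_ratio_num_factor r r' s s' c j : (1 <= j < b)%N ->
  {in predC1 i, r =1 r'} -> {in predC1 j, s =1 s'} ->
  exists d, gt_ratio k b i r s c = d * (c - s j) /\
            gt_ratio k b i r' s' c = d * (c - s' j).
Proof.
move=> jb rr' ss'; exists ((\prod_(1 <= m < b | m != j) (c - s m))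
  / \prod_(1 <= m < k.+1 | m != i) (c - r m)).
rewrite /gt_ratio !(big_natD1 _ (P := predT) _ (i := j)) //=.
rewrite (eq_bigr (fun m => c - s m) (F1 := fun m => c - s' m)) => [|m /ss' -> //].
rewrite (eq_bigr (fun m => c - r m) (F1 := fun m => c - r' m)) => [|m /rr' -> //].
by split; rewrite -[LHS]mulrA [LHS]mulrC.
Qed.

End GTRatio.

Section Coefficients.
Variable R : realType.
Implicit Types (v w d : arr R) (k l i j : nat).

Lemma arr_addAC w d d' : arr_add (arr_sub w d) d' = arr_sub (arr_add w d') d.
Proof. exact: addrAC. Qed.

Lemma arr_subK w d : arr_add (arr_sub w d) d = w.
Proof. exact: subrK. Qed.

Lemma arr_addK w d : arr_sub (arr_add w d) d = w.
Proof. exact: addrK. Qed.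

Lemma arr_add_row w k i l : l != k -> arr_add w (delta R k i) l =1 w l.
Proof. by move=> /negbTE lk j; rewrite /arr_add /delta lk addr0. Qed.

Lemma arr_sub_row w k i l : l != k -> arr_sub w (delta R k i) l =1 w l.
Proof. by move=> /negbTE lk j; rewrite /arr_sub /delta lk subr0. Qed.

Lemma coef_eE v k i : coef_e v k i = gt_ratio k k.+2 i (v k) (v k.+1) (v k i).
Proof. by rewrite /coef_e /gt_ratio; case: eqP => // ->; rewrite invr0 mulr0. Qed.

Lemma coef_fE v k i : coef_f v k i = gt_ratio k k i (v k) (v k.-1) (v k i).
Proof. by rewrite /coef_f /gt_ratio; case: eqP => // ->; rewrite invr0 mulr0. Qed.

Lemma coef_e_sub v k i : coef_e (arr_sub v (delta R k i)) k i =
  gt_ratio k k.+2 i (v k) (v k.+1) (v k i - 1).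
Proof.
rewrite coef_eE [X in gt_ratio _ _ _ _ _ X]/arr_sub /delta !eqxx.
apply: eq_gt_ratio => [j /negbTE ji|]; last by apply: arr_sub_row; lia.
by rewrite /arr_sub ji andbF subr0.
Qed.

Lemma coef_f_add v k i : (1 <= k)%N -> coef_f (arr_add v (delta R k i)) k i =
  gt_ratio k k i (v k) (v k.-1) (v k i + 1).
Proof.
move=> k1; rewrite coef_fE [X in gt_ratio _ _ _ _ _ X]/arr_add /delta !eqxx.
apply: eq_gt_ratio => [j /negbTE ji|]; last by apply: arr_add_row; lia.
by rewrite /arr_add ji andbF addr0.
Qed.

Lemma coef_e_f_comm_row w k i j : (1 <= i <= k)%N -> (1 <= j <= k)%N -> i != j ->
  coef_e (arr_sub w (delta R k i)) k i
    * coef_f (arr_sub (arr_add w (delta R k j)) (delta R k i)) k j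
  = coef_f (arr_add w (delta R k j)) k j
    * coef_e (arr_sub (arr_add w (delta R k j)) (delta R k i)) k i.
Proof.
move=> ik jk ij; have k1 : (1 <= k)%N by lia.
rewrite -{1}arr_addAC !coef_e_sub !coef_f_add //.
set v := arr_add w _; set u := arr_sub w _.
have vE m : v k m = w k m + (m == j)%:R by rewrite /v /arr_add /delta eqxx.
have uE m : u k m = w k m - (m == i)%:R by rewrite /u /arr_sub /delta eqxx.
have -> : v k i = w k i by rewrite vE (negbTE ij) addr0.
have -> : u k j = w k j by rewrite uE eq_sym (negbTE ij) subr0.
have [|||c [-> ->]] := @gt_ratio_den_factor _ k k.+2 i (w k) (v k) (w k.+1) (v k.+1)
  (w k i - 1) j jk.
- by rewrite eq_sym.
- by move=> m /negbTE mj; rewrite vE mj addr0.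
- by move=> m; rewrite /v arr_add_row //; lia.
have [||d [-> ->]] := @gt_ratio_den_factor _ k k j (w k) (u k) (w k.-1) (u k.-1)
  (w k j + 1) i ik ij.
- by move=> m /negbTE mi; rewrite uE mi subr0.
- by move=> m; rewrite /u arr_sub_row //; lia.
by rewrite vE uE !eqxx !mulf_div [c * d]mulrC; congr (_ / _); ring.
Qed.

Lemma coef_e_f_comm_next w k i j : (1 <= i <= k)%N -> (1 <= j <= k.+1)%N ->
  coef_e (arr_sub w (delta R k i)) k i
    * coef_f (arr_sub (arr_add w (delta R k.+1 j)) (delta R k i)) k.+1 j
  = coef_f (arr_add w (delta R k.+1 j)) k.+1 j
    * coef_e (arr_sub (arr_add w (delta R k.+1 j)) (delta R k i)) k i.
Proof.
move=> ik jk; rewrite -{1}arr_addAC !coef_e_sub !coef_f_add //=.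
set v := arr_add w _; set u := arr_sub w _.
have vE : v k =1 w k by apply: arr_add_row; lia.
have uE : u k.+1 =1 w k.+1 by apply: arr_sub_row; lia.
rewrite uE vE.
have [||c [-> ->]] := @gt_ratio_num_factor _ k k.+2 i (w k) (v k) (w k.+1) (v k.+1)
  (w k i - 1) j jk; first by move=> m _; rewrite vE.
  by move=> m /negbTE mj; rewrite /v /arr_add /delta mj andbF addr0.
have [||d [-> ->]] := @gt_ratio_num_factor _ k.+1 k.+1 j (w k.+1) (u k.+1) (w k) (u k)
  (w k.+1 j + 1) i ik; first by move=> m _; rewrite uE.
  by move=> m /negbTE mi; rewrite /u /arr_sub /delta mi andbF subr0.
by rewrite /v /u /arr_sub /arr_add /delta !eqxx; ring.
Qed.

Lemma coef_e_f_comm w k i l j : (1 <= i <= k)%N -> (1 <= j <= l)%N ->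
  (k, i) != (l, j) ->
  coef_e (arr_sub w (delta R k i)) k i
    * coef_f (arr_sub (arr_add w (delta R l j)) (delta R k i)) l j
  = coef_f (arr_add w (delta R l j)) l j
    * coef_e (arr_sub (arr_add w (delta R l j)) (delta R k i)) k i.
Proof.
move=> ik jl; rewrite xpair_eqE.
case: (eqVneq k l) jl => [<-|kl] jl /=; first exact: coef_e_f_comm_row.
move=> _; case: (eqVneq l k.+1) jl => [->|lk] jl; first exact: coef_e_f_comm_next.
rewrite -{1}arr_addAC !coef_e_sub !coef_f_add; [|lia..].
have add_row m : m != l -> arr_add w (delta R l j) m = w m.
  by move=> ml; apply: funext; apply: arr_add_row.
have sub_row m : m != k -> arr_sub w (delta R k i) m = w m.
  by move=> mk; apply: funext; apply: arr_sub_row.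
by rewrite !add_row ?sub_row 1?mulrC //; lia.
Qed.

End Coefficients.

(** * Gelfand-Tsetlin patterns *)

Section NatLe.
Variable F : numDomainType.
Implicit Types x y z : F.

Definition natle x y : Prop := exists t : nat, y = x + t%:R.

Lemma natle_refl x : natle x x.
Proof. by exists 0%N; rewrite addr0. Qed.

Lemma natle_trans y x z : natle x y -> natle y z -> natle x z.
Proof. by move=> [s ->] [t ->]; exists (s + t)%N; rewrite natrD addrA. Qed.

Lemma natleDr x y (t : nat) : natle x y -> natle x (y + t%:R).
Proof. by move=> xy; apply: natle_trans xy _; exists t. Qed.

Lemma natleBl x y (t : nat) : natle x y -> natle (x - t%:R) y.
Proof. by apply: natle_trans; exists t; rewrite subrK. Qed.

Lemma natle_add1 x y : natle x y -> x <> y -> natle (x + 1) y.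
Proof.
move=> [[|t] ->]; first by rewrite addr0.
by move=> _; exists t; rewrite -natr1 -addrA [1 + _]addrC.
Qed.

Lemma natle_sub1 x y : natle x y -> x <> y -> natle x (y - 1).
Proof. by move=> xy /(natle_add1 xy)[t ->]; exists t; rewrite addrAC addrK. Qed.

Lemma natle_add1_irrefl x : ~ natle (x + 1) x.
Proof.
move=> [t] /eqP; rewrite -addrA -subr_eq0 opprD addNKr oppr_eq0 addrC natr1.
by rewrite pnatr_eq0.
Qed.

End NatLe.

Section Patterns.
Variable R : realType.
Local Notation C := R[i].
Variables (n : nat) (a : nat -> C).
Implicit Types (v w : arr R) (k l i j : nat).

Definition in_triangle k i := [&& 1 <= i, i <= k & k <= n.+1]%N.

Definition GTpattern v : Prop :=
  [/\ forall k i, ~~ in_triangle k i -> v k i = 0,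
      forall i, (1 <= i <= n.+1)%N -> v n.+1 i = a i,
      forall k i, (1 <= i <= k)%N -> (k <= n)%N -> natle (v k i) (v k.+1 i)
    & forall k i j, (1 <= i <= k)%N -> (k <= n)%N -> (i < j <= k.+1)%N ->
        ~ natle (v k i) (v k.+1 j)].

Lemma GTpattern_row v k i j : GTpattern v ->
  (1 <= i)%N -> (i < j <= k)%N -> (k <= n.+1)%N -> ~ natle (v k i) (v k j).
Proof.
move=> [_ _ vert diag] i1; case: k => [|k] ijk kn; first by lia.
move=> vij; apply: (diag k i j) => //; first by lia.
by apply: natle_trans vij; apply: vert => //; lia.
Qed.

Lemma GTpattern_row_inj v k i j : GTpattern v -> (1 <= i <= k)%N -> (1 <= j <= k)%N ->
  (k <= n.+1)%N -> v k i = v k j -> i = j.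
Proof.
move=> Pv ik jk kn vij; case: (ltngtP i j) => // ij; exfalso.
- apply: (@GTpattern_row v k i j) => //; [lia|lia|rewrite vij; exact: natle_refl].
- apply: (@GTpattern_row v k j i) => //; [lia|lia|rewrite vij; exact: natle_refl].
Qed.

Lemma GTpattern_row_succ v k i l : GTpattern v ->
  (1 <= i <= k)%N -> (1 <= l <= k)%N -> (k <= n)%N -> v k i = v k l + 1 ->
  [/\ (i < k)%N, v k i = v k.-1 i & v k l = v k.+1 l].
Proof.
move=> Pv ik lk kn vil; have [_ _ vert diag] := Pv.
have il : (i < l)%N.
  rewrite ltnNge leq_eqVlt; apply/negP => /predU1P[li|li].
    by apply: (@natle_add1_irrefl _ (v k l)); rewrite -vil li; apply: natle_refl.
  by apply: (@GTpattern_row v k l i) => //; [lia|lia|lia|rewrite vil; exists 1%N].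
split; first by lia.
- case: k => [|k] in ik lk kn vil il *; first by lia.
  apply: contrapT => /= /nesym vi; apply: (diag k i l); [lia|lia|lia|].
  have -> : v k.+1 l = v k.+1 i - 1 by rewrite vil addrK.
  by apply: natle_sub1 vi; apply: vert; lia.
- apply: contrapT => vl; apply: (diag k i l) => //; first by lia.
  by rewrite vil; apply: natle_add1 => //; apply: vert; lia.
Qed.

Lemma GTpattern_addP v k i : GTpattern v -> (1 <= i <= k)%N -> (k <= n)%N ->
  GTpattern (arr_add v (delta R k i)) <->
  v k i <> v k.+1 i /\ forall j, (1 <= j < i)%N -> v k.-1 j <> v k i + 1.
Proof.
move=> [out top vert diag] ik kn.
have k1k : (k.+1 == k) = false by lia.
rewrite /arr_add /delta; split=> [[_ _ vert' diag']|[vi vj]].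
  split=> [vi|j ji vj].
    have := vert' k i ik kn; rewrite !eqxx k1k addr0 vi; exact: natle_add1_irrefl.
  case: k => [|k] in ik kn k1k vert' diag' vj *; first by lia.
  apply: (diag' k j i); [lia|lia|lia|rewrite !eqxx (_ : (k == k.+1) = false)]; last by lia.
  by rewrite /= addr0 -vj; apply: natle_refl.
split=> [k' i' out'|i' i'n|k' i' ik' kn'|k' i' j' ik' kn' ij].
- rewrite out //; suff -> : (k' == k) && (i' == i) = false by rewrite addr0.
  by apply: contraNF out' => /andP[/eqP-> /eqP->]; rewrite /in_triangle; lia.
- by rewrite top // (_ : (n.+1 == k) = false) ?addr0 //; lia.
- have := vert _ _ ik' kn'.
  have [/andP[/eqP-> /eqP->]|_] := boolP ((k' == k) && (i' == i)); last first.
    by rewrite addr0; apply: natleDr.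
  by rewrite k1k addr0 => vert_i; apply: natle_add1.
- have [/andP[/eqP k'k /eqP j'i]|_] := boolP ((k'.+1 == k) && (j' == i)).
    rewrite k'k j'i (_ : (k' == k) = false) ?addr0; last by lia.
    move=> vi'; apply: (diag k' i' j') => //; rewrite k'k j'i -(addrK 1 (v k i)).
    apply: natle_sub1 vi' _; rewrite (_ : k' = k.-1); [apply: vj|by rewrite -k'k].
    by rewrite -j'i; lia.
  rewrite addr0 => vi'; apply: (diag k' i' j') => //.
  by apply: natle_trans vi'; apply/natleDr/natle_refl.
Qed.

Lemma GTpattern_subP v k i : GTpattern v -> (1 <= i <= k)%N -> (k <= n)%N ->
  GTpattern (arr_sub v (delta R k i)) <->
  ((i < k)%N -> v k i <> v k.-1 i) /\
  forall j, (i < j <= k.+1)%N -> v k.+1 j <> v k i - 1.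
Proof.
move=> [out top vert diag] ik kn.
have k1k : (k.+1 == k) = false by lia.
rewrite /arr_sub /delta; split=> [[_ _ vert' diag']|[vi vj]].
  split=> [i_k vi|j ij vj].
    case: k => [|k] in ik kn k1k vert' diag' i_k vi *; first by lia.
    have := vert' k i ltac:(lia) ltac:(lia).
    rewrite !eqxx (_ : (k == k.+1) = false) /= ?subr0 ?vi; last by lia.
    by rewrite -{1}[v k i](subrK 1) /=; apply: natle_add1_irrefl.
  apply: (diag' k i j) => //; rewrite !eqxx k1k /= subr0 vj; exact: natle_refl.
split=> [k' i' out'|i' i'n|k' i' ik' kn'|k' i' j' ik' kn' ij].
- rewrite out //; suff -> : (k' == k) && (i' == i) = false by rewrite subr0.
  by apply: contraNF out' => /andP[/eqP-> /eqP->]; rewrite /in_triangle; lia.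
- by rewrite top // (_ : (n.+1 == k) = false) ?subr0 //; lia.
- have := vert _ _ ik' kn'.
  have [/andP[/eqP k'k /eqP i'i]|_] := boolP ((k'.+1 == k) && (i' == i)); last first.
    by rewrite subr0; apply: natleBl.
  rewrite k'k i'i (_ : (k' == k) = false) ?subr0; last by lia.
  move=> vert_i; apply: natle_sub1 => // e; apply: vi; [lia|by rewrite -e -k'k].
- have [/andP[/eqP k'k /eqP i'i]|_] := boolP ((k' == k) && (i' == i)).
    rewrite k'k i'i k1k subr0 => vj'; apply: (diag k i j'); [lia|lia|lia|].
    rewrite -(subrK 1 (v k i)); apply: natle_add1 => // e.
    by apply: (vj j'); [lia|rewrite -e].
  rewrite subr0 => vi'; apply: (diag k' i' j') => //.
  by rewrite -[v k'.+1 j'](subrK ((k'.+1 == k) && (j' == i))%:R); apply: natleDr.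
Qed.

(* An inequality broken by raising (lowering) one entry can only be restored by lowering
   (raising) that same entry. *)
Lemma GTpattern_add_of_addsub v k i l j : GTpattern v ->
  (1 <= i <= k)%N -> (k <= n)%N -> (k, i) != (l, j) ->
  GTpattern (arr_sub (arr_add v (delta R k i)) (delta R l j)) ->
  GTpattern (arr_add v (delta R k i)).
Proof.
move=> Pv ik kn; rewrite xpair_eqE => /negbTE ne [_ _ vert diag]; apply/GTpattern_addP => //.
rewrite /arr_sub /arr_add /delta in vert diag; split=> [vi|i' i'i vi'].
  have := vert k i ik kn; rewrite !eqxx ne (_ : (k.+1 == k) = false) /=; last by lia.
  rewrite addr0 subr0 vi => /(@natleDr _ _ _ ((k.+1 == l) && (i == j))).
  by rewrite subrK; apply: natle_add1_irrefl.
case: k => [|k] in ik kn ne vert diag vi' *; first by lia.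
apply: (diag k i' i); [lia|lia|lia|rewrite !eqxx ne (_ : (k == k.+1) = false)]; last by lia.
by rewrite /= addr0 subr0 -vi'; apply/natleBl/natle_refl.
Qed.

Lemma GTpattern_sub_of_addsub v k i l j : GTpattern v ->
  (1 <= j <= l)%N -> (l <= n)%N -> (k, i) != (l, j) ->
  GTpattern (arr_sub (arr_add v (delta R k i)) (delta R l j)) ->
  GTpattern (arr_sub v (delta R l j)).
Proof.
move=> Pv jl ln; rewrite xpair_eqE (eq_sym k) (eq_sym i) => /negbTE ne [_ _ vert diag].
apply/GTpattern_subP => //.
rewrite /arr_sub /arr_add /delta in vert diag; split=> [j_l vj|j' jj' vj'].
  case: l => [|l] in jl ln ne vert diag j_l vj *; first by lia.
  have := vert l j ltac:(lia) ltac:(lia).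
  rewrite !eqxx ne (_ : (l == l.+1) = false) /= ?addr0 ?subr0 ?vj; last by lia.
  move=> /(natleBl ((l == k) && (j == i))); rewrite addrK -{1}[v l j](subrK 1).
  exact: natle_add1_irrefl.
apply: (diag l j j') => //; rewrite !eqxx ne (_ : (l.+1 == l) = false) /=; last by lia.
by rewrite addr0 subr0 vj'; apply/natleDr/natle_refl.
Qed.

Lemma coef_e_f_sub_eq0 v k i : GTpattern v -> (1 <= i <= k)%N -> (k <= n)%N ->
  ~ GTpattern (arr_sub v (delta R k i)) ->
  coef_e (arr_sub v (delta R k i)) k i * coef_f v k i = 0.
Proof.
move=> Pv ik kn notP; apply: contrapT => ne; apply/notP/GTpattern_subP => //.
split=> [i_k vi|j ij vj]; apply: ne.
- by rewrite coef_fE (gt_ratio_eq0 _ _ _ _ vi) ?mulr0 //; lia.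
- by rewrite coef_e_sub (gt_ratio_eq0 _ _ _ _ (esym vj)) ?mul0r //; lia.
Qed.

Lemma coef_f_e_add_eq0 v k i : GTpattern v -> (1 <= i <= k)%N -> (k <= n)%N ->
  ~ GTpattern (arr_add v (delta R k i)) ->
  coef_f (arr_add v (delta R k i)) k i * coef_e v k i = 0.
Proof.
move=> Pv ik kn notP; apply: contrapT => ne; apply/notP/GTpattern_addP => //.
split=> [vi|j ji vj]; apply: ne.
- by rewrite coef_eE (gt_ratio_eq0 _ _ _ _ vi) ?mulr0 //; lia.
- by rewrite coef_f_add ?(gt_ratio_eq0 _ _ _ _ (esym vj)) ?mul0r //; lia.
Qed.

Lemma coef_e_neq0 v k i : GTpattern v -> (1 <= i <= k)%N -> (k <= n)%N ->
  v k i <> v k.+1 i -> coef_e v k i != 0.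
Proof.
move=> Pv ik kn ne; have [_ _ vert diag] := Pv.
rewrite coef_eE; apply: gt_ratio_neq0 => j jk vij; last first.
  by apply/esym/(GTpattern_row_inj Pv _ _ _ vij); lia.
case: (ltngtP i j) => ij; last by apply: ne; rewrite vij ij.
  by apply: (diag k i j); [lia|lia|lia|rewrite vij; apply: natle_refl].
case: k => [|k] in ik kn ne jk vij *; first by lia.
apply: (diag k j i); [lia|lia|lia|rewrite vij].
by apply: (@natle_trans _ (v k.+1 j)); apply: vert; lia.
Qed.

Lemma coef_f_neq0 v k i : GTpattern v -> GTpattern (arr_sub v (delta R k i)) ->
  (1 <= i <= k)%N -> (k <= n)%N -> coef_f v k i != 0.
Proof.
move=> Pv Pw ik kn; have [_ _ vert diag] := Pv; have [vi _] := (GTpattern_subP Pv ik kn).1 Pw.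
rewrite coef_fE; apply: gt_ratio_neq0 => j jk vij; last first.
  by apply/esym/(GTpattern_row_inj Pv _ _ _ vij); lia.
case: k => [|k] in ik kn Pw vi jk vij *; first by lia.
case: (ltngtP i j) => ij; last by apply: vi; rewrite ?vij ij //; lia.
  apply: (GTpattern_row Pv (k := k.+1) (i := i) (j := j)); [lia|lia|lia|].
  by rewrite vij; apply: vert; lia.
by apply: (diag k j i); [lia|lia|lia|rewrite vij; apply: natle_refl].
Qed.

End Patterns.

(** * Modules generated by lowering operators *)

Section Subspaces.
Variables (K : pzRingType) (V : lmodType K).

Definition subspace (U : V -> Prop) : Prop :=
  U 0 /\ forall c x y, U x -> U y -> U (c *: x + y).

Variable U : V -> Prop.
Hypothesis U_sub : subspace U.

Lemma subspaceD x y : U x -> U y -> U (x + y).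
Proof. by move=> Ux Uy; rewrite -[x]scale1r; apply: U_sub.2. Qed.

Lemma subspaceZ c x : U x -> U (c *: x).
Proof. by move=> Ux; rewrite -[_ *: _]addr0; apply: U_sub.2 => //; apply: U_sub.1. Qed.

Lemma subspaceB x y : U x -> U y -> U (x - y).
Proof. by move=> Ux Uy; rewrite addrC -scaleN1r; apply: U_sub.2. Qed.

Lemma subspace_sum (I : eqType) (r : seq I) (P : pred I) (f : I -> V) :
  (forall i, i \in r -> P i -> U (f i)) -> U (\sum_(i <- r | P i) f i).
Proof.
move=> Uf; rewrite big_seq_cond; apply: (big_ind U) => [|x y|i /andP[/Uf]//].
  exact: U_sub.1.
exact: subspaceD.
Qed.

End Subspaces.

Section LinearFunctions.
Variables (K : pzRingType) (V W : lmodType K) (f : V -> W).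
Hypothesis f_linear : linear f.

Lemma linear_fun0 : f 0 = 0.
Proof. by rewrite -[0 in LHS]subr0 (GRing.zmod_morphism_linear f_linear) subrr. Qed.

Lemma linear_funZ c x : f (c *: x) = c *: f x.
Proof. exact: GRing.scalable_linear. Qed.

Lemma linear_funD x y : f (x + y) = f x + f y.
Proof. by rewrite -[x in LHS]scale1r f_linear scale1r. Qed.

End LinearFunctions.

Lemma linear_on_sum (K : pzRingType) (V W : lmodType K) (U : V -> Prop) (f : V -> W) :
  subspace U -> (forall c x y, U x -> U y -> f (c *: x + y) = c *: f x + f y) ->
  forall (I : eqType) (r : seq I) (c : I -> K) (x : I -> V), (forall i, U (x i)) ->
  f (\sum_(i <- r) c i *: x i) = \sum_(i <- r) c i *: f (x i).
Proof.
move=> U_sub f_lin I r c x Ux; have [U0 _] := U_sub.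
have f0 : f 0 = 0 by rewrite -[in LHS](addNr 0) -scaleN1r f_lin // scaleN1r addNr.
elim: r => [|i r IHr]; first by rewrite !big_nil.
rewrite !big_cons f_lin ?IHr //; apply: subspace_sum => // m _ _.
exact: subspaceZ.
Qed.

Definition cartan_entry (K : pzRingType) (k l : nat) : K :=
  2 * (k == l)%:R - (k == l.+1)%:R - (k.+1 == l)%:R.

(* The relations of sl_(n+1) that the comparison of highest weight modules needs; the Serre
   relations and [h_k, h_l] = 0 are not among them. *)
Definition chevalley_rel (K : pzRingType) (n : nat) (P : lmodType K)
    (E F H : nat -> P -> P) : Prop :=
  [/\ forall k, linear (E k), forall k, linear (F k), forall k, linear (H k),
      forall k l x, (1 <= k <= n)%N -> (1 <= l <= n)%N ->
        E k (F l x) = F l (E k x) + (if k == l then H k x else 0)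
    & forall k l x, (1 <= k <= n)%N -> (1 <= l <= n)%N ->
        H k (F l x) = F l (H k x) - cartan_entry K k l *: F l x].

Definition pair_op (V W : Type) (f : nat -> V -> V) (g : nat -> W -> W)
    (k : nat) (p : V * W) : V * W := (f k p.1, g k p.2).

Lemma pair_op_linear (K : pzRingType) (V W : lmodType K)
    (f : nat -> V -> V) (g : nat -> W -> W) k :
  linear (f k) -> linear (g k) -> linear (pair_op f g k).
Proof. by move=> lf lg c p p'; rewrite /pair_op /= lf lg. Qed.

Lemma chevalley_rel_pair (K : pzRingType) n (V W : lmodType K)
    (E F H : nat -> V -> V) (E' F' H' : nat -> W -> W) :
  chevalley_rel n E F H -> chevalley_rel n E' F' H' ->
  chevalley_rel n (pair_op E E') (pair_op F F') (pair_op H H').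
Proof.
move=> [lE lF lH EF HF] [lE' lF' lH' EF' HF'].
split=> [k|k|k|k l p kn ln|k l p kn ln]; try exact: pair_op_linear.
  by rewrite /pair_op /= EF // EF' //; case: eqP => _; rewrite ?addr0.
by rewrite /pair_op /= HF // HF'.
Qed.

Section LoweringSpan.
Variables (K : pzRingType) (n : nat) (P : lmodType K).
Variables (E F H : nat -> P -> P) (p0 : P).

Inductive lowering_span : P -> Prop :=
| lowering_span_gen : lowering_span p0
| lowering_span_lin c x y :
    lowering_span x -> lowering_span y -> lowering_span (c *: x + y)
| lowering_span_F k x : (1 <= k <= n)%N -> lowering_span x -> lowering_span (F k x).

Lemma lowering_span_subspace : subspace lowering_span.
Proof.
split=> [|c x y]; last exact: lowering_span_lin.
rewrite -[0](addNr p0) -scaleN1r.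
by apply: lowering_span_lin; apply: lowering_span_gen.
Qed.

Hypothesis rel : chevalley_rel n E F H.
Variable m : nat -> K.
Hypothesis E_p0 : forall k, (1 <= k <= n)%N -> E k p0 = 0.
Hypothesis H_p0 : forall k, (1 <= k <= n)%N -> H k p0 = m k *: p0.

Lemma lowering_span_H k x : (1 <= k <= n)%N -> lowering_span x -> lowering_span (H k x).
Proof.
have [_ _ H_lin _ HF] := rel; have sub := lowering_span_subspace.
move=> kn; elim=> [|c {}x y _ IHx _ IHy|l {}x ln x_span IHx].
- by rewrite H_p0 //; apply/(subspaceZ sub)/lowering_span_gen.
- by rewrite H_lin; apply: lowering_span_lin.
- rewrite HF //; apply: (subspaceB sub); first exact: lowering_span_F.
  by apply/(subspaceZ sub)/lowering_span_F.
Qed.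

Lemma lowering_span_E k x : (1 <= k <= n)%N -> lowering_span x -> lowering_span (E k x).
Proof.
have [E_lin _ _ EF _] := rel; have sub := lowering_span_subspace.
move=> kn; elim=> [|c {}x y _ IHx _ IHy|l {}x ln x_span IHx].
- by rewrite E_p0 //; apply: sub.1.
- by rewrite E_lin; apply: lowering_span_lin.
- rewrite EF //; apply: (subspaceD sub); first exact: lowering_span_F.
  by case: eqP => _; [apply: lowering_span_H|apply: sub.1].
Qed.

End LoweringSpan.

Section LoweringSpanPair.
Variables (K : pzRingType) (n : nat) (V W : lmodType K).
Variables (F : nat -> V -> V) (F' : nat -> W -> W) (v0 : V) (w0 : W).
Local Notation pair_span := (lowering_span n (pair_op F F') (v0, w0)).

Lemma lowering_span_snd p : pair_span p -> lowering_span n F' w0 p.2.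
Proof.
elim=> [|c x y _ IHx _ IHy|k x kn _ IHx]; first exact: lowering_span_gen.
  exact: lowering_span_lin.
exact: lowering_span_F.
Qed.

Lemma lowering_span_lift w : lowering_span n F' w0 w -> exists v, pair_span (v, w).
Proof.
elim=> [|c x y _ [v v_span] _ [v' v'_span]|k x kn _ [v v_span]].
- by exists v0; apply: lowering_span_gen.
- by exists (c *: v + v'); apply: (lowering_span_lin c v_span v'_span).
- by exists (F k v); apply: (lowering_span_F kn v_span).
Qed.

End LoweringSpanPair.

(** * Modules over sl_(n+1) *)

Section Matrices.
Variables (R : realType) (n : nat).
Local Notation C := R[i].
Local Notation M := 'M[C]_(n.+1).
Local Notation Eu := (Eu R n).
Local Notation gt_e := (gt_e R n).
Local Notation gt_f := (gt_f R n).
Local Notation gt_h := (gt_h R n).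
Implicit Types (x y : M).

Lemma EuM a b c d : (1 <= b <= n.+1)%N ->
  Eu a b *m Eu c d = (b.-1 == c.-1)%:R *: Eu a d.
Proof.
move=> bn; have bn' : (b.-1 < n.+1)%N by lia.
apply/matrixP => i j; rewrite !mxE (bigD1 (Ordinal bn')) //= big1 ?addr0.
  by rewrite !mxE /= eqxx andbT -!natrM !mulnb andbCA.
by move=> l lb; rewrite !mxE (negbTE (_ : (l : nat) != b.-1)) // andbF mul0r.
Qed.

Lemma Eu_delta (i j : 'I_n.+1) : Eu i.+1 j.+1 = delta_mx i j.
Proof. by apply/matrixP => i' j'; rewrite !mxE. Qed.

Lemma sl_Eu a b : (1 <= a)%N -> (1 <= b)%N -> a != b -> sl (Eu a b).
Proof.
move=> a1 b1 ab; rewrite /sl /mxtrace big1 // => i _; rewrite mxE.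
by case: eqP => //= ->; rewrite (_ : (a.-1 == b.-1) = false) //; lia.
Qed.

Lemma sl_lie x y : sl (lie x y).
Proof. by rewrite /sl /lie mxtraceD raddfN /= mxtrace_mulC subrr. Qed.

Lemma sl_subspace : subspace (@sl R n).
Proof.
split=> [|c x y]; first exact: mxtrace0.
by rewrite /sl => x0 y0; rewrite mxtraceD mxtraceZ x0 y0 mulr0 addr0.
Qed.

Lemma sl_gt_e k : (1 <= k <= n)%N -> sl (gt_e k).
Proof. by move=> kn; apply: sl_Eu; lia. Qed.

Lemma sl_gt_f k : (1 <= k <= n)%N -> sl (gt_f k).
Proof. by move=> kn; apply: sl_Eu; lia. Qed.

Lemma nplus_gt_e k : (1 <= k)%N -> nplus (gt_e k).
Proof. by move=> k1 i j ji; rewrite mxE; case: eqP => //= ik; case: eqP => //= jk; lia. Qed.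

Lemma lie_gt_ef k l : (1 <= k <= n)%N -> (1 <= l <= n)%N ->
  lie (gt_e k) (gt_f l) = if k == l then gt_h k else 0.
Proof.
move=> kn ln; rewrite /lie !EuM; [|lia|lia].
rewrite !succnK (_ : (l.-1 == k.-1) = (k == l)); last by lia.
by case: eqP => [->|_]; rewrite ?scale1r ?scale0r ?subrr.
Qed.

Lemma cartan_gt_h k : (1 <= k <= n)%N -> cartan (gt_h k).
Proof.
move=> kn; split; last by have := sl_lie (gt_e k) (gt_f k); rewrite lie_gt_ef ?eqxx.
apply/is_diag_mxP => i j ij; rewrite !mxE.
have off m : ((i : nat) == m) && ((j : nat) == m) = false.
  by apply: contraNF ij => /andP[/eqP-> /eqP->].
by rewrite !off subrr.
Qed.

Lemma lie_gt_hf k l : (1 <= k <= n)%N -> (1 <= l <= n)%N ->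
  lie (gt_h k) (gt_f l) = - cartan_entry R[i] k l *: gt_f l.
Proof.
move=> kn ln; rewrite /lie /gt_h mulmxBl mulmxBr !EuM; [|lia|lia|lia|lia].
rewrite /= /cartan_entry.
have -> : (k.-1 == l) = (k == l.+1) by lia.
have -> : (l.-1 == k.-1) = (k == l) by lia.
have -> : (l.-1 == k) = (k.+1 == l) by lia.
have eqZ (b : bool) x : (b -> x = gt_f l) -> b%:R *: x = b%:R *: gt_f l.
  by case: b => [->//|_]; rewrite !scale0r.
rewrite !eqZ -?scalerBl; try by move/eqP=> ->.
by congr (_ *: _); ring.
Qed.

(* Up to a scalar matrix this is diag(0, -1, ..., -n); it grades f-monomials by length. *)
Definition grading_mx : M :=
  let d := diag_mx (\row_i - (i : nat)%:R) in d - ((\tr d) / n.+1%:R)%:M.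

Lemma cartan_grading : cartan grading_mx.
Proof.
split; last first.
  rewrite /grading_mx mxtraceD raddfN /= mxtrace_scalar -[X in _ - X]mulr_natr divfK ?subrr //.
  by rewrite pnatr_eq0.
apply/is_diag_mxP => i j ij; rewrite !mxE.
by rewrite (negbTE (_ : i != j)) ?mulr0n ?subrr //; apply: contraNneq ij => ->.
Qed.

Lemma lie_grading_f l : (1 <= l <= n)%N -> lie grading_mx (gt_f l) = - gt_f l.
Proof.
move=> ln; rewrite /lie /grading_mx mulmxBl mulmxBr scalar_mxC opprB addrA subrK.
apply/matrixP => i j; rewrite mul_diag_mx mul_mx_diag !mxE.
have [/andP[/eqP -> /eqP ->]|_] := boolP (_ && _); last by rewrite mulr0 mul0r subrr oppr0.
by rewrite succnK -[in LHS](prednK (_ : (0 < l)%N)) ?succnK -?natr1; [ring|lia].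
Qed.

Definition sl_basis (i j : 'I_n.+1) : M :=
  if i == j then delta_mx i i - delta_mx ord_max ord_max else delta_mx i j.

Lemma sl_sum_basis x : sl x -> x = \sum_i \sum_j x i j *: sl_basis i j.
Proof.
move=> x0; have -> : \sum_i \sum_j x i j *: sl_basis i j =
    \sum_i (\sum_j x i j *: delta_mx i j - x i i *: delta_mx ord_max ord_max).
  apply: eq_bigr => i _; rewrite (bigD1 i) //= [in RHS](bigD1 i) //= addrAC.
  rewrite -scalerBr {1}/sl_basis eqxx; congr (_ + _); apply: eq_bigr => j ji.
  by rewrite /sl_basis eq_sym (negbTE ji).
by rewrite sumrB -matrix_sum_delta -scaler_suml -/(\tr x) x0 scale0r subr0.
Qed.

Section Generation.
Variable A : M -> Prop.
Hypotheses (A_sub : subspace A) (A_lie : forall x y, A x -> A y -> A (lie x y)).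
Hypothesis A_e : forall k, (1 <= k <= n)%N -> A (gt_e k).
Hypothesis A_f : forall k, (1 <= k <= n)%N -> A (gt_f k).

Lemma gen_Eu_upper i d : (1 <= i)%N -> (i + d.+1 <= n.+1)%N -> A (Eu i (i + d.+1)).
Proof.
move=> i1; elim: d => [|d IHd] idn; first by rewrite addn1; apply: A_e; lia.
have -> : Eu i (i + d.+2) = lie (Eu i (i + d.+1)) (gt_e (i + d.+1)).
  rewrite /lie !EuM; [|lia|lia]; rewrite eqxx (_ : (_ == i.-1) = false); last by lia.
  by rewrite scale1r scale0r subr0 addnS.
by apply: A_lie; [apply: IHd|apply: A_e]; lia.
Qed.

Lemma gen_Eu_lower i d : (1 <= i)%N -> (i + d.+1 <= n.+1)%N -> A (Eu (i + d.+1) i).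
Proof.
move=> i1; elim: d => [|d IHd] idn; first by rewrite addn1; apply: A_f; lia.
have -> : Eu (i + d.+2) i = lie (gt_f (i + d.+1)) (Eu (i + d.+1) i).
  rewrite /lie !EuM; [|lia|lia]; rewrite eqxx (_ : (i.-1 == _) = false); last by lia.
  by rewrite scale1r scale0r subr0 addnS.
by apply: A_lie; [apply: A_f|apply: IHd]; lia.
Qed.

Lemma gen_delta_mx (i j : 'I_n.+1) : i != j -> A (delta_mx i j).
Proof.
move=> ij; rewrite -Eu_delta; have := ltn_ord i; have := ltn_ord j => jn iN.
case: (ltngtP i j) => [lt|gt|/ord_inj e].
- rewrite (_ : j.+1 = (i.+1 + (j - i.+1).+1)%N); last by lia.
  by apply: gen_Eu_upper; lia.
- rewrite (_ : i.+1 = (j.+1 + (i - j.+1).+1)%N); last by lia.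
  by apply: gen_Eu_lower; lia.
- by rewrite e eqxx in ij.
Qed.

Lemma sl_generated x : sl x -> A x.
Proof.
move=> /sl_sum_basis ->; do 2!(apply: subspace_sum => // ? _ _).
apply: subspaceZ => //; set i := (X in sl_basis X _); set j := (X in sl_basis _ X).
rewrite /sl_basis; case: eqVneq => [_|]; last exact: gen_delta_mx.
have [->|im] := eqVneq i ord_max; first by rewrite subrr; apply: A_sub.1.
have -> : delta_mx i i - delta_mx ord_max ord_max =
    lie (delta_mx i ord_max) (delta_mx ord_max i) :> M by rewrite /lie !mul_delta_mx.
by apply: A_lie; apply: gen_delta_mx; rewrite // eq_sym.
Qed.

End Generation.
End Matrices.

Section GModules.
Variables (R : realType) (n : nat).
Local Notation C := R[i].
Local Notation M := 'M[C]_(n.+1).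
Local Notation gt_e := (gt_e R n).
Local Notation gt_f := (gt_f R n).
Local Notation gt_h := (gt_h R n).
Variables (V : lmodType C) (rho : M -> V -> V).
Hypothesis gm : is_gmod rho.

Lemma gmod_linear x : linear (rho x).
Proof. by case: gm => lin _ _; apply: lin. Qed.

Lemma gmod_lie x y v : sl x -> sl y ->
  rho (lie x y) v = rho x (rho y v) - rho y (rho x v).
Proof. by case: gm => _ _; apply. Qed.

Lemma gmod_linearl c x y v : sl x -> sl y -> rho (c *: x + y) v = c *: rho x v + rho y v.
Proof. by case: gm => _ lin _; apply: lin. Qed.

Lemma gmod0l v : rho 0 v = 0.
Proof.
have sl0 := (sl_subspace R n).1; have := gmod_linearl 1 v sl0 sl0.
by rewrite !scale1r addr0 => e; apply: (addrI (rho 0 v)); rewrite -e addr0.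
Qed.

Lemma gmodZl c x v : sl x -> rho (c *: x) v = c *: rho x v.
Proof.
by move=> sx; rewrite -[c *: x]addr0 gmod_linearl ?gmod0l ?addr0 //; apply: (sl_subspace R n).1.
Qed.

Lemma gmod_chevalley_rel :
  chevalley_rel n (fun k => rho (gt_e k)) (fun k => rho (gt_f k)) (fun k => rho (gt_h k)).
Proof.
split=> [k|k|k|k l v kn ln|k l v kn ln]; try exact: gmod_linear.
  have := gmod_lie v (sl_gt_e R kn) (sl_gt_f R ln); rewrite lie_gt_ef // fun_if if_arg gmod0l.
  by move=> ->; rewrite addrC subrK.
have := gmod_lie v (cartan_gt_h R kn).2 (sl_gt_f R ln); rewrite lie_gt_hf // gmodZl.
  by rewrite scaleNr => ->; rewrite addrC subrK.
exact: sl_gt_f.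
Qed.

Lemma gmod_grading_f l v : (1 <= l <= n)%N ->
  rho (grading_mx R n) (rho (gt_f l) v) =
  rho (gt_f l) (rho (grading_mx R n) v) - rho (gt_f l) v.
Proof.
move=> ln; have := gmod_lie v (cartan_grading R n).2 (sl_gt_f R ln).
rewrite lie_grading_f // -(scaleN1r (gt_f l)) gmodZl; last exact: sl_gt_f.
by rewrite scaleN1r => ->; rewrite addrC subrK.
Qed.

Lemma submodule_chevalley (U : V -> Prop) : subspace U ->
  (forall k v, (1 <= k <= n)%N -> U v -> U (rho (gt_e k) v)) ->
  (forall k v, (1 <= k <= n)%N -> U v -> U (rho (gt_f k) v)) ->
  submodule rho U.
Proof.
move=> U_sub Ue Uf; pose A (x : M) := sl x /\ forall v, U v -> U (rho x v).
have A_sub : subspace A.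
  split=> [|c x y [slx Ax] [sly Ay]].
    by split=> [|v _]; [exact: (sl_subspace R n).1|rewrite gmod0l; apply: U_sub.1].
  split=> [|v Uv]; first exact: (sl_subspace R n).2.
  by rewrite gmod_linearl //; apply: U_sub.2; [apply: Ax|apply: Ay].
have A_lie x y : A x -> A y -> A (lie x y).
  move=> [slx Ax] [sly Ay]; split=> [|v Uv]; first exact: sl_lie.
  by rewrite gmod_lie //; apply: subspaceB => //; [apply/Ax/Ay|apply/Ay/Ax].
split=> [||c v|x v slx]; first exact: U_sub.1.
- by move=> v w; apply: subspaceD.
- exact: subspaceZ.
suff [_] : A x by apply.
apply: sl_generated slx => // k kn.
  by split=> [|v']; [apply: sl_gt_e|apply: Ue].
by split=> [|v']; [apply: sl_gt_f|apply: Uf].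
Qed.

End GModules.

(** * Comparison of highest weight modules *)

Section LowerVectors.
Variables (R : realType) (n : nat).
Local Notation C := R[i].
Local Notation M := 'M[C]_(n.+1).
Local Notation gt_f := (gt_f R n).
Local Notation grading := (grading_mx R n).
Variables (V : lmodType C) (rho : M -> V -> V).
Hypothesis gm : is_gmod rho.
Variable d : C.

Definition grade_shift (m : nat) (x : V) : V := rho grading x - (d - m%:R) *: x.
Local Notation grade_shifts s := (foldr grade_shift ^~ s).

(* x is a sum of generalized eigenvectors of the grading element for eigenvalues d - m with
   m > 0. *)
Definition lower_vector (x : V) : Prop := exists2 s, 0%N \notin s & grade_shifts s x = 0.

Lemma grade_shift_linear m : linear (grade_shift m).
Proof.
move=> c x y; rewrite /grade_shift (gmod_linear gm) scalerDr scalerBr !scalerA.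
by rewrite opprD addrACA [c * _]mulrC.
Qed.

Lemma grade_shifts_linear s : linear (grade_shifts s).
Proof. by elim: s => //= m s IHs c x y; rewrite IHs grade_shift_linear. Qed.

Lemma grade_shiftC m m' x : grade_shift m (grade_shift m' x) = grade_shift m' (grade_shift m x).
Proof.
have gradingB y c z : rho grading (y - c *: z) = rho grading y - c *: rho grading z.
  by rewrite -!scaleNr [in LHS]addrC (gmod_linear gm) addrC.
rewrite /grade_shift !gradingB !scalerBr !scalerA [X in _ = _ - (_ - X *: x)]mulrC.
by rewrite !opprB !addrA [LHS]addrAC [RHS]addrAC; congr (_ + _); exact: addrAC.
Qed.

Lemma grade_shiftsC s t x :
  grade_shifts s (grade_shifts t x) = grade_shifts t (grade_shifts s x).
Proof.
elim: s => //= m s ->; elim: t => //= m' t <-.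
by rewrite grade_shiftC.
Qed.

Lemma lower_vector_subspace : subspace lower_vector.
Proof.
split=> [|c x y [s s0 xs] [t t0 yt]]; first by exists [::].
exists (s ++ t); first by rewrite mem_cat negb_or s0.
rewrite grade_shifts_linear !foldr_cat yt grade_shiftsC xs.
by rewrite !(linear_fun0 (grade_shifts_linear _)) scaler0 addr0.
Qed.

Lemma grade_shift_f k m x : (1 <= k <= n)%N ->
  grade_shift m.+1 (rho (gt_f k) x) = rho (gt_f k) (grade_shift m x).
Proof.
move=> kn; rewrite /grade_shift gmod_grading_f // -!scaleNr.
rewrite (linear_funD (gmod_linear gm _)) (linear_funZ (gmod_linear gm _)) -addrA.
congr (_ + _); rewrite -scaleN1r -scalerDl; congr (_ *: _).
by rewrite -natr1; ring.
Qed.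

Lemma lower_vector_f k x : (1 <= k <= n)%N -> lower_vector x ->
  lower_vector (rho (gt_f k) x).
Proof.
move=> kn [s _ xs]; exists (map succn s); first by apply/mapP=> -[].
rewrite -[RHS](linear_fun0 (gmod_linear gm (gt_f k))) -[in RHS]xs; elim: s {xs} => //= m s ->.
exact: grade_shift_f.
Qed.

Variable v0 : V.
Hypothesis grading_v0 : rho grading v0 = d *: v0.

Lemma grade_shifts_v0 s : grade_shifts s v0 = (\prod_(m <- s) m%:R) *: v0.
Proof.
elim: s => [|m s /= ->]; first by rewrite big_nil scale1r.
rewrite /grade_shift (linear_funZ (gmod_linear gm _)) grading_v0 big_cons !scalerA -scalerBl.
by congr (_ *: _); ring.
Qed.

Lemma lower_vector_f_v0 k : (1 <= k <= n)%N -> lower_vector (rho (gt_f k) v0).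
Proof.
move=> kn; exists [:: 1%N] => //=; rewrite grade_shift_f // /grade_shift grading_v0 subr0 subrr.
exact: linear_fun0 (gmod_linear gm _).
Qed.

Lemma lower_vectorZ_v0 c : v0 <> 0 -> lower_vector (c *: v0) -> c = 0.
Proof.
move=> v0_neq0 [s s0]; rewrite (linear_funZ (grade_shifts_linear s)) grade_shifts_v0 scalerA.
move=> /eqP; rewrite scaler_eq0 mulf_eq0 (introF eqP v0_neq0) orbF => /orP[/eqP //|].
rewrite prodf_seq_eq0 => /hasP[m ms /=]; rewrite pnatr_eq0 => /eqP m0.
by rewrite -m0 ms in s0.
Qed.

End LowerVectors.

(* The submodule of V x N generated by the two highest weight vectors is the graph of an
   isomorphism: projecting it to V or to N is injective because V is simple and N is cyclic
   and cocyclic on its highest weight vector. *)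
Section HighestWeightComparison.
Variables (R : realType) (n : nat).
Local Notation C := R[i].
Local Notation M := 'M[C]_(n.+1).
Local Notation gt_e := (gt_e R n).
Local Notation gt_f := (gt_f R n).
Local Notation gt_h := (gt_h R n).

Variables (V : lmodType C) (rho : M -> V -> V) (lam : M -> C) (v0 : V).
Hypotheses (gm : is_gmod rho) (simple : simple_gmod rho) (hw : hw_vector rho id lam v0).

Variables (N : lmodType C) (E F H : nat -> N -> N) (t0 : N).
Hypothesis rel : chevalley_rel n E F H.
Hypothesis E_t0 : forall k, (1 <= k <= n)%N -> E k t0 = 0.
Hypothesis H_t0 : forall k, (1 <= k <= n)%N -> H k t0 = lam (gt_h k) *: t0.

Variable pr : N -> C^o.
Hypotheses (pr_linear : linear pr) (pr_t0 : pr t0 = 1).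
Hypothesis pr_F : forall k t, (1 <= k <= n)%N -> pr (F k t) = 0.

Local Notation N0 := (lowering_span n F t0).
Hypothesis cocyclic : forall K : N -> Prop, subspace K ->
  (forall k t, (1 <= k <= n)%N -> K t -> K (E k t)) ->
  (forall t, K t -> N0 t) -> forall t, K t -> t <> 0 -> K t0.

Local Notation rho_ g := (fun k => rho (g k)).
Local Notation hw_graph := (lowering_span n (pair_op (rho_ gt_f) F) (v0, t0)).

Lemma hw_graph_subspace : subspace hw_graph.
Proof. exact: lowering_span_subspace. Qed.

Lemma hw_graph_lin c x t y s : hw_graph (x, t) -> hw_graph (y, s) ->
  hw_graph (c *: x + y, c *: t + s).
Proof. exact: hw_graph_subspace.2. Qed.

Lemma hw_graph_chevalley_rel :
  chevalley_rel n (pair_op (rho_ gt_e) E) (pair_op (rho_ gt_f) F) (pair_op (rho_ gt_h) H).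
Proof. exact/chevalley_rel_pair/rel/gmod_chevalley_rel. Qed.

Lemma hw_pair_h k : (1 <= k <= n)%N ->
  pair_op (rho_ gt_h) H k (v0, t0) = lam (gt_h k) *: (v0, t0).
Proof.
by move=> kn; have [_ h_v0 _] := hw; rewrite /pair_op (h_v0 _ (cartan_gt_h R kn)) H_t0.
Qed.

Lemma hw_pair_e k : (1 <= k <= n)%N -> pair_op (rho_ gt_e) E k (v0, t0) = 0.
Proof.
move=> kn; have [_ _ e_v0] := hw; rewrite /pair_op E_t0 // e_v0 //.
by apply: nplus_gt_e; lia.
Qed.

Lemma hw_graph_h k p : (1 <= k <= n)%N -> hw_graph p -> hw_graph (pair_op (rho_ gt_h) H k p).
Proof.
exact: (lowering_span_H hw_graph_chevalley_rel (m := fun k => lam (gt_h k)) hw_pair_h).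
Qed.

Lemma hw_graph_e k p : (1 <= k <= n)%N -> hw_graph p -> hw_graph (pair_op (rho_ gt_e) E k p).
Proof.
exact: (lowering_span_E hw_graph_chevalley_rel (m := fun k => lam (gt_h k)) hw_pair_e hw_pair_h).
Qed.

Lemma hw_graph_f k p : (1 <= k <= n)%N -> hw_graph p -> hw_graph (pair_op (rho_ gt_f) F k p).
Proof. exact: lowering_span_F. Qed.

Local Notation lower := (lower_vector rho (lam (grading_mx R n))).

Lemma hw_grading_v0 : rho (grading_mx R n) v0 = lam (grading_mx R n) *: v0.
Proof. by have [_ h_v0 _] := hw; apply/h_v0/cartan_grading. Qed.

Lemma hw_graph_lower p : hw_graph p -> lower (p.1 - pr p.2 *: v0).
Proof.
have sub := lower_vector_subspace gm (lam (grading_mx R n)).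
elim=> [|c {}p q _ IHp _ IHq|k {}p kn _ IHp] /=.
- by rewrite pr_t0 scale1r subrr; apply: sub.1.
- by rewrite pr_linear scalerDl opprD -scalerA addrACA -scalerBr; apply: sub.2.
- rewrite pr_F // scale0r subr0 -[p.1](subrK (pr p.2 *: v0)).
  rewrite (linear_funD (gmod_linear gm _)) (linear_funZ (gmod_linear gm _)).
  apply: (subspaceD sub); first exact: lower_vector_f.
  by apply: (subspaceZ sub); apply: lower_vector_f_v0 => //; apply: hw_grading_v0.
Qed.

Lemma hw_graph_v0 c t : hw_graph (c *: v0, t) -> c = pr t.
Proof.
have [v0_neq0 _ _] := hw; move=> /hw_graph_lower /=; rewrite -scalerBl.
by move/(lower_vectorZ_v0 gm hw_grading_v0 v0_neq0)/eqP; rewrite subr_eq0 => /eqP.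
Qed.

Lemma hw_graph_left0 x : hw_graph (x, 0) -> x = 0.
Proof.
have [E_lin F_lin _ _ _] := rel; have [_ simpleV] := simple.
have ker_sub : submodule rho (fun x => hw_graph (x, 0)).
  apply: (submodule_chevalley gm) => [|k v kn gv|k v kn gv].
  - split=> [|c y z gy gz]; first exact: hw_graph_subspace.1.
    by have := hw_graph_lin c gy gz; rewrite scaler0 addr0.
  - by have := hw_graph_e kn gv; rewrite /pair_op /= (linear_fun0 (E_lin k)).
  - by have := hw_graph_f kn gv; rewrite /pair_op /= (linear_fun0 (F_lin k)).
case: (simpleV _ ker_sub) => [ker0 /ker0 //|/(_ v0) gv0].
have /eqP : 1 = pr 0 by apply: hw_graph_v0; rewrite scale1r.
by rewrite (linear_fun0 pr_linear) oner_eq0.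
Qed.

Lemma hw_graph_right0 t : hw_graph (0, t) -> t = 0.
Proof.
move=> gt; apply: contrapT => t_neq0.
suff gt0 : hw_graph (0, t0).
  have /eqP : 0 = pr t0 by apply: hw_graph_v0; rewrite scale0r.
  by rewrite pr_t0 eq_sym oner_eq0.
apply: (cocyclic (K := fun s => hw_graph (0, s)) _ _ _ gt t_neq0) => [|k s kn gs|s].
- split=> [|c s s' gs gs']; first exact: hw_graph_subspace.1.
  by have := hw_graph_lin c gs gs'; rewrite scaler0 addr0.
- by have := hw_graph_e kn gs; rewrite /pair_op /= (linear_fun0 (gmod_linear gm _)).
- exact: lowering_span_snd.
Qed.

Lemma hw_graph_fun x y t : hw_graph (x, t) -> hw_graph (y, t) -> x = y.
Proof.
move=> gx gy; apply/eqP; rewrite -subr_eq0 addrC; apply/eqP/hw_graph_left0.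
by have := hw_graph_lin (-1) gy gx; rewrite !scaleN1r addNr.
Qed.

Lemma hw_graph_surj x : exists t, hw_graph (x, t).
Proof.
have [_ simpleV] := simple; have [v0_neq0 _ _] := hw.
have dom_sub : submodule rho (fun x => exists t, hw_graph (x, t)).
  apply: (submodule_chevalley gm) => [|k v kn [t gv]|k v kn [t gv]].
  - split=> [|c y z [t gy] [s gz]]; first by exists 0; apply: hw_graph_subspace.1.
    by exists (c *: t + s); apply: hw_graph_lin.
  - by exists (E k t); apply: (hw_graph_e kn gv).
  - by exists (F k t); apply: (hw_graph_f kn gv).
case: (simpleV _ dom_sub) => [dom0|/(_ x) //].
by case: v0_neq0; apply: dom0; exists t0; apply: lowering_span_gen.
Qed.

Definition module_iso_on (j : N -> V) : Prop :=
  [/\ forall c s t, N0 s -> N0 t -> j (c *: s + t) = c *: j s + j t,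
      forall t, N0 t -> j t = 0 -> t = 0,
      forall x, exists2 t, N0 t & j t = x
    & forall k t, (1 <= k <= n)%N -> N0 t ->
        [/\ j (E k t) = rho (gt_e k) (j t), j (F k t) = rho (gt_f k) (j t)
          & j (H k t) = rho (gt_h k) (j t)]].

Lemma highest_weight_iso : exists j : N -> V, module_iso_on j.
Proof.
have [j j_graph] : exists j : N -> V, forall t, N0 t -> hw_graph (j t, t).
  have graph_ex t : exists x, N0 t -> hw_graph (x, t).
    have [/(lowering_span_lift (rho_ gt_f) v0)[x gx]|nt] := pselect (N0 t).
      by exists x.
    by exists 0.
  by have [j j_graph] := choice graph_ex; exists j.
have jE x t : hw_graph (x, t) -> j t = x.
  by move=> gx; apply: hw_graph_fun (gx); apply/j_graph/(lowering_span_snd gx).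
exists j; split=> [c s t Ns Nt|t Nt jt|x|k t kn Nt].
- by apply/jE/hw_graph_lin; apply: j_graph.
- by apply: hw_graph_right0; rewrite -jt; apply: j_graph.
- by have [t gx] := hw_graph_surj x; exists t; [apply: (lowering_span_snd gx)|apply: jE].
- have gt := j_graph t Nt.
  by split; apply: jE;
    [apply: (hw_graph_e kn gt)|apply: (hw_graph_f kn gt)|apply: (hw_graph_h kn gt)].
Qed.

End HighestWeightComparison.

(** * The module of coordinate functions *)

Lemma coef_h_add (R : realType) (w : arr R) k l j : (1 <= j <= l)%N -> (1 <= k)%N ->
  coef_h (arr_add w (delta R l j)) k = coef_h w k + cartan_entry R[i] k l.
Proof.
move=> jl k1.
have sumD m : \sum_(1 <= i < m.+1) arr_add w (delta R l j) m i =
    \sum_(1 <= i < m.+1) w m i + (m == l)%:R.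
  rewrite big_split /=; congr (_ + _); rewrite /delta.
  have [->|_] := eqVneq m l; last by rewrite big1.
  rewrite (bigD1_seq j) /= ?mem_index_iota ?iota_uniq //.
  by rewrite eqxx big1 ?addr0 // => i /negbTE ->.
rewrite /coef_h -[in RHS](prednK k1) -[in LHS](prednK k1) /= !sumD /cartan_entry /=.
by rewrite eqSS; ring.
Qed.

Section GTOperators.
Variables (R : realType) (n : nat) (a : nat -> R[i]).
Local Notation C := R[i].
Local Notation GTpattern := (GTpattern n a).
Implicit Types (v w u : arr R) (k i j : nat) (phi psi : arr R -> C^o) (c : C).

Definition on_patterns phi : arr R -> C^o :=
  fun w => if `[< GTpattern w >] then phi w else 0.

Definition pattern_shift (f : arr R -> arr R) (g : arr R -> C) phi : arr R -> C^o :=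
  on_patterns (fun w => g w * on_patterns phi (f w)).

Definition GTe_term k i : (arr R -> C^o) -> arr R -> C^o :=
  pattern_shift (fun w => arr_sub w (delta R k i))
    (fun w => - coef_e (arr_sub w (delta R k i)) k i).
Definition GTf_term k i : (arr R -> C^o) -> arr R -> C^o :=
  pattern_shift (fun w => arr_add w (delta R k i))
    (fun w => coef_f (arr_add w (delta R k i)) k i).

(* The Gelfand-Tsetlin formulas transposed to coordinate functions: if phi lists the
   coordinates of a vector in the basis T(v), then GTe k phi, GTf k phi and GTh k phi list
   those of its images under e_k, f_k and h_k. *)
Definition GTe k phi : arr R -> C^o := \sum_(1 <= i < k.+1) GTe_term k i phi.
Definition GTf k phi : arr R -> C^o := \sum_(1 <= i < k.+1) GTf_term k i phi.
Definition GTh k phi : arr R -> C^o := on_patterns (fun w => coef_h w k * phi w).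

Lemma scalefctE c phi w : (c *: phi) w = c * phi w.
Proof. by []. Qed.

Lemma on_patternsT phi w : GTpattern w -> on_patterns phi w = phi w.
Proof. by move=> Pw; rewrite /on_patterns asboolT. Qed.

Lemma on_patternsF phi w : ~ GTpattern w -> on_patterns phi w = 0.
Proof. by move=> Pw; rewrite /on_patterns asboolF. Qed.

Lemma on_patterns_linear : linear on_patterns.
Proof.
move=> c phi psi; apply: funext => w; rewrite !fctE /on_patterns.
by case: asboolP => _; rewrite ?scaler0 ?addr0.
Qed.

Lemma pattern_shift_linear f g : linear (pattern_shift f g).
Proof.
move=> c phi psi; rewrite /pattern_shift -on_patterns_linear; congr on_patterns.
by apply: funext => w; rewrite on_patterns_linear !fctE mulrDr scalerAr.
Qed.

HB.instance Definition _ k i := GRing.isLinear.Build C (arr R -> C^o) (arr R -> C^o) *:%R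
  (GTe_term k i) (pattern_shift_linear _ _).

HB.instance Definition _ k i := GRing.isLinear.Build C (arr R -> C^o) (arr R -> C^o) *:%R
  (GTf_term k i) (pattern_shift_linear _ _).

Lemma GTeE k phi w : GTe k phi w = \sum_(1 <= i < k.+1) GTe_term k i phi w.
Proof. by rewrite /GTe fct_sumE. Qed.

Lemma GTfE k phi w : GTf k phi w = \sum_(1 <= i < k.+1) GTf_term k i phi w.
Proof. by rewrite /GTf fct_sumE. Qed.

Lemma GTe_linear k : linear (GTe k).
Proof.
move=> c phi psi; rewrite /GTe scaler_sumr -big_split /=.
by apply: eq_bigr => i _; apply: pattern_shift_linear.
Qed.

Lemma GTf_linear k : linear (GTf k).
Proof.
move=> c phi psi; rewrite /GTf scaler_sumr -big_split /=.
by apply: eq_bigr => i _; apply: pattern_shift_linear.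
Qed.

HB.instance Definition _ k := GRing.isLinear.Build C (arr R -> C^o) (arr R -> C^o) *:%R
  (GTf k) (GTf_linear k).

Lemma GTh_linear k : linear (GTh k).
Proof.
move=> c phi psi; rewrite /GTh -on_patterns_linear; congr on_patterns.
by apply: funext => w; rewrite !fctE mulrDr scalerAr.
Qed.

HB.instance Definition _ k := GRing.isLinear.Build C (arr R -> C^o) (arr R -> C^o) *:%R
  (GTh k) (GTh_linear k).

Lemma GTe_GTf_termC phi k i l j :
  (1 <= i <= k)%N -> (k <= n)%N -> (1 <= j <= l)%N -> (l <= n)%N ->
  (k, i) != (l, j) -> GTe_term k i (GTf_term l j phi) = GTf_term l j (GTe_term k i phi).
Proof.
move=> ik kn jl ln ne; apply: funext => w; rewrite /GTe_term /GTf_term /pattern_shift.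
have [Pw|nPw] := pselect (GTpattern w); last by rewrite !on_patternsF.
rewrite !(on_patternsT _ Pw); set u := arr_sub (arr_add w (delta R l j)) (delta R k i).
have [Pu|nPu] := pselect (GTpattern u); last first.
  by rewrite /on_patterns /= arr_addAC -/u (asboolF nPu) !mulr0 !if_same !mulr0.
have ne' : (l, j) != (k, i) by rewrite eq_sym.
have Padd := GTpattern_add_of_addsub Pw jl ln ne' Pu.
have Psub := GTpattern_sub_of_addsub Pw ik kn ne' Pu.
rewrite !(on_patternsT _ Psub) !(on_patternsT _ Padd) arr_addAC -/u !(on_patternsT _ Pu).
by rewrite !mulNr mulrN !mulrA coef_e_f_comm.
Qed.

Lemma pattern_shiftK f g f' g' phi w : cancel f f' -> GTpattern w ->
  (~ GTpattern (f w) -> g w * g' (f w) = 0) ->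
  pattern_shift f g (pattern_shift f' g' phi) w = g w * g' (f w) * phi w.
Proof.
move=> fK Pw exit; rewrite /pattern_shift on_patternsT //.
have [Pfw|nPfw] := pselect (GTpattern (f w)); last by rewrite exit // on_patternsF ?mulr0 ?mul0r.
by rewrite !(on_patternsT _ Pfw) fK on_patternsT // mulrA.
Qed.

Lemma GTe_GTf_term_diag phi k i w : GTpattern w -> (1 <= i <= k)%N -> (k <= n)%N ->
  GTe_term k i (GTf_term k i phi) w =
  - (coef_e (arr_sub w (delta R k i)) k i * coef_f w k i) * phi w.
Proof.
move=> Pw ik kn; rewrite [LHS]pattern_shiftK //= ?arr_subK ?mulNr // => [u|nPw].
  exact: arr_subK.
by rewrite (coef_e_f_sub_eq0 Pw) ?oppr0.
Qed.

Lemma GTf_GTe_term_diag phi k i w : GTpattern w -> (1 <= i <= k)%N -> (k <= n)%N ->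
  GTf_term k i (GTe_term k i phi) w =
  - (coef_f (arr_add w (delta R k i)) k i * coef_e w k i) * phi w.
Proof.
move=> Pw ik kn; rewrite [LHS]pattern_shiftK //= ?arr_addK ?mulrN // => [u|nPw].
  exact: arr_addK.
by rewrite (coef_f_e_add_eq0 Pw) ?oppr0.
Qed.

Lemma sum_GT_term_diag phi k : (1 <= k <= n)%N ->
  \sum_(1 <= i < k.+1)
    (GTe_term k i (GTf_term k i phi) - GTf_term k i (GTe_term k i phi)) = GTh k phi.
Proof.
case: k => [|k] kn; first by lia.
apply: funext => w; rewrite fct_sumE /GTh.
have [Pw|nPw] := pselect (GTpattern w); last first.
  rewrite on_patternsF // big1 // => i _.
  by rewrite !fctE /GTe_term /GTf_term /pattern_shift !on_patternsF ?subr0.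
rewrite on_patternsT // /coef_h -(@sum_gt_residue _ k (w k.+1) (w k.+2) (w k)); first last.
- by move=> i l ik lk; apply: (GTpattern_row_succ Pw); lia.
- by move=> i l ik lk; apply: (GTpattern_row_inj Pw); lia.
rewrite mulr_suml !big_nat; apply: eq_bigr => i ik.
rewrite addrfctE opprfctE GTe_GTf_term_diag ?GTf_GTe_term_diag //.
by rewrite coef_f_add // coef_e_sub coef_eE coef_fE /=; ring.
Qed.

Lemma GTe_GTf phi k l : (1 <= k <= n)%N -> (1 <= l <= n)%N ->
  GTe k (GTf l phi) = GTf l (GTe k phi) + (if k == l then GTh k phi else 0).
Proof.
move=> kn ln; apply/eqP; rewrite addrC -subr_eq; apply/eqP; rewrite /GTe /GTf.
under eq_bigr do rewrite linear_sum.
under [X in _ - X]eq_bigr do rewrite linear_sum.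
rewrite [X in _ - X]exchange_big -sumrB /=.
have [<-|kl] := eqVneq k l; last first.
  rewrite big_nat big1 // => i ik; rewrite -sumrB big_nat big1 // => j jl.
  have ne : (k, i) != (l, j) by rewrite xpair_eqE (negbTE kl).
  by rewrite GTe_GTf_termC ?subrr //; lia.
rewrite -sum_GT_term_diag // !big_nat; apply: eq_bigr => i ik.
rewrite -sumrB (bigD1_seq i) /= ?mem_index_iota ?iota_uniq //.
rewrite [X in _ + X]big1_seq ?addr0 // => j /andP[ji]; rewrite mem_index_iota => jk.
have ne : (k, i) != (k, j) by rewrite xpair_eqE eqxx eq_sym.
by rewrite GTe_GTf_termC ?subrr //; lia.
Qed.

Lemma GTh_GTf phi k l : (1 <= k)%N -> (1 <= l)%N ->
  GTh k (GTf l phi) = GTf l (GTh k phi) - cartan_entry R[i] k l *: GTf l phi.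
Proof.
move=> k1 l1; rewrite /GTf linear_sum scaler_sumr -sumrB !big_nat; apply: eq_bigr => j jl /=.
apply: funext => w; rewrite addrfctE opprfctE scalefctE /= /GTh /GTf_term /pattern_shift.
have [Pw|nPw] := pselect (GTpattern w); last by rewrite !on_patternsF // mulr0 subr0.
rewrite !(on_patternsT _ Pw); set w' := arr_add _ _.
have [Pw'|nPw'] := pselect (GTpattern w'); last by rewrite !on_patternsF // !mulr0 subr0.
by rewrite !(on_patternsT _ Pw') coef_h_add //; ring.
Qed.

Lemma GT_chevalley_rel : @chevalley_rel C n (arr R -> C^o) GTe GTf GTh.
Proof.
split; [exact: GTe_linear|exact: GTf_linear|exact: GTh_linear|..] => k l phi kn ln.
  exact: GTe_GTf.
by apply: GTh_GTf; lia.
Qed.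

Definition GTbasis u : arr R -> C^o := on_patterns (fun w => `[< w = u >]%:R).

Lemma GTbasisE u w : GTpattern u -> GTbasis u w = `[< w = u >]%:R.
Proof.
move=> Pu; rewrite /GTbasis; have [Pw|nPw] := pselect (GTpattern w).
  by rewrite on_patternsT.
by rewrite on_patternsF // asboolF // => wu; apply: nPw; rewrite wu.
Qed.

Lemma GTbasis_out u : ~ GTpattern u -> GTbasis u = 0.
Proof.
move=> nPu; apply: funext => w; rewrite /GTbasis; have [Pw|] := pselect (GTpattern w).
  by rewrite on_patternsT // asboolF // => wu; apply: nPu; rewrite -wu.
exact: on_patternsF.
Qed.

Lemma GTbasis_neq0 u w : GTbasis u w <> 0 -> GTpattern w /\ w = u.
Proof. by rewrite /GTbasis /on_patterns; case: asboolP => // Pw; case: asboolP. Qed.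

Lemma on_patterns_basis u : on_patterns (GTbasis u) = GTbasis u.
Proof. by apply: funext => w; rewrite /GTbasis /on_patterns; case: asboolP. Qed.

Lemma pattern_shift_basis f g f' v : cancel f f' -> cancel f' f -> GTpattern v ->
  pattern_shift f g (GTbasis v) = g (f' v) *: GTbasis (f' v).
Proof.
move=> fK f'K Pv; apply: funext => w; rewrite scalefctE /pattern_shift.
have [Pw|nPw] := pselect (GTpattern w); last by rewrite /GTbasis !on_patternsF ?mulr0.
rewrite on_patternsT // on_patterns_basis GTbasisE // /GTbasis on_patternsT //.
have [->|ne] := pselect (w = f' v); first by rewrite f'K !asboolT.
by rewrite !asboolF ?mulr0 // => e; apply: ne; rewrite -e fK.
Qed.

Lemma GTe_basis k v : GTpattern v -> GTe k (GTbasis v) =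
  \sum_(1 <= i < k.+1) (- coef_e v k i) *: GTbasis (arr_add v (delta R k i)).
Proof.
move=> Pv; apply: eq_bigr => i _.
rewrite [LHS](@pattern_shift_basis _ _ (fun w => arr_add w (delta R k i))) ?arr_addK // => w.
  exact: arr_subK.
exact: arr_addK.
Qed.

Lemma GTf_basis k v : GTpattern v -> GTf k (GTbasis v) =
  \sum_(1 <= i < k.+1) coef_f v k i *: GTbasis (arr_sub v (delta R k i)).
Proof.
move=> Pv; apply: eq_bigr => i _.
rewrite [LHS](@pattern_shift_basis _ _ (fun w => arr_sub w (delta R k i))) ?arr_subK // => w.
  exact: arr_addK.
exact: arr_subK.
Qed.

Lemma GTh_basis k v : GTpattern v -> GTh k (GTbasis v) = coef_h v k *: GTbasis v.
Proof.
move=> Pv; apply: funext => w; rewrite scalefctE /GTh.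
have [Pw|nPw] := pselect (GTpattern w); last by rewrite /GTbasis !on_patternsF ?mulr0.
by rewrite on_patternsT // GTbasisE //; case: asboolP => [->//|_]; rewrite !mulr0.
Qed.

Definition GTspan phi : Prop :=
  exists s : seq (C * arr R), phi = \sum_(p <- s) p.1 *: GTbasis p.2.

Lemma GTspan_basis u : GTspan (GTbasis u).
Proof. by exists [:: (1, u)]; rewrite big_seq1 scale1r. Qed.

Lemma GTspan_subspace : subspace GTspan.
Proof.
split=> [|c _ _ [s ->] [t ->]]; first by exists [::]; rewrite big_nil.
exists ([seq (c * p.1, p.2) | p <- s] ++ t); rewrite big_cat big_map scaler_sumr.
by congr (_ + _); apply: eq_bigr => p _; rewrite scalerA.
Qed.

Lemma GTspan_GTf k phi : GTspan phi -> GTspan (GTf k phi).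
Proof.
move=> [s ->]; rewrite linear_sum; apply: (subspace_sum GTspan_subspace) => p _ _.
rewrite linearZ /=; apply: (subspaceZ GTspan_subspace).
have [Pp|nPp] := pselect (GTpattern p.2).
  rewrite GTf_basis //; apply: (subspace_sum GTspan_subspace) => i _ _.
  exact/(subspaceZ GTspan_subspace)/GTspan_basis.
by rewrite GTbasis_out // linear0; apply: GTspan_subspace.1.
Qed.

Lemma GTspan_patterns phi : GTspan phi ->
  exists m (w : 'I_m -> arr R) (c : 'I_m -> C),
    (forall l, GTpattern (w l)) /\ phi = \sum_(l < m) c l *: GTbasis (w l).
Proof.
move=> [s ->]; pose s' := [seq p <- s | `[< GTpattern p.2 >]].
exists (size s'), (fun l => (tnth (in_tuple s') l).2), (fun l => (tnth (in_tuple s') l).1).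
split=> [l|]; first by have := mem_tnth l (in_tuple s'); rewrite mem_filter => /andP[/asboolP].
rewrite -(big_tnth _ _ s' predT (fun p => p.1 *: GTbasis p.2)) big_filter [RHS]big_mkcond /=.
by apply: eq_bigr => p _; case: asboolP => // /GTbasis_out ->; rewrite scaler0.
Qed.

Lemma GTbasis_free m (w : 'I_m -> arr R) (c : 'I_m -> C) : injective w ->
  (forall l, GTpattern (w l)) -> \sum_(l < m) c l *: GTbasis (w l) = 0 ->
  forall l, c l = 0.
Proof.
move=> w_inj Pw /(congr1 (fun phi => phi (w _))) sum0 l; have := sum0 l.
rewrite fct_sumE (bigD1 l) //= scalefctE GTbasisE // asboolT // mulr1 big1 ?addr0 // => i il.
by rewrite scalefctE GTbasisE // asboolF ?mulr0 // => /w_inj li; rewrite li eqxx in il.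
Qed.

End GTOperators.

Section GTIrreducibility.
Variables (R : realType) (n : nat) (a : nat -> R[i]).
Local Notation C := R[i].
Local Notation GTpattern := (GTpattern n a).
Local Notation GTbasis := (GTbasis n a).
Local Notation GTe := (GTe n a).
Local Notation GTf := (GTf n a).
Implicit Types (v w u : arr R) (k l m i j : nat) (phi : arr R -> C^o).

Definition aligned m v := forall k i, (1 <= i <= k)%N -> (k < m)%N -> v k i = v k.+1 i.

Lemma aligned_add v k i : GTpattern v -> aligned k v -> (1 <= i <= k)%N -> (k <= n)%N ->
  v k i <> v k.+1 i -> GTpattern (arr_add v (delta R k i)).
Proof.
move=> Pv al ik kn ne; apply/GTpattern_addP => //; split=> // j ji vj.
have [_ _ vert diag] := Pv; apply: (diag k j i); [lia|lia|lia|].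
have := al k.-1 j; rewrite prednK; last by lia.
by move=> <-; [rewrite vj; apply: natle_add1 => //; apply: vert|lia|lia].
Qed.

Lemma aligned_swap v k i j : aligned k v -> (1 <= i <= k)%N -> (1 <= j <= k)%N ->
  i != j -> ~ aligned k (arr_sub (arr_add v (delta R k i)) (delta R k j)).
Proof.
case: k => [|k] al ik jk ij al'; first by lia.
have row_eq m : (1 <= m <= k)%N -> (m == i)%:R - (m == j)%:R = 0 :> C.
  move=> mk; have := al' k m mk (ltnSn k).
  rewrite /arr_sub /arr_add /delta eqxx (_ : (k == k.+1) = false); last by lia.
  rewrite addr0 subr0 -(al k m mk (ltnSn k)) /= -addrA => /esym/eqP.
  by rewrite addrC -subr_eq0 addrK => /eqP.
have [jk'|kj] := leqP j k.
  have := row_eq j ltac:(lia); rewrite eqxx eq_sym (negbTE ij) sub0r => /eqP.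
  by rewrite oppr_eq0 oner_eq0.
by have := row_eq i ltac:(lia); rewrite eqxx (negbTE ij) subr0 => /eqP; rewrite oner_eq0.
Qed.

Definition GTtop : arr R := fun k i => if in_triangle n k i then a i else 0.

Lemma GTtopE k i : (1 <= i <= k)%N -> (k <= n.+1)%N -> GTtop k i = a i.
Proof. by move=> ik kn; rewrite /GTtop /in_triangle (_ : [&& _, _ & _]) //; lia. Qed.

Lemma coef_h_top k : (1 <= k <= n)%N -> coef_h GTtop k = a k - a k.+1 - 1.
Proof.
move=> kn; have row_sum m : (m <= n.+1)%N ->
    \sum_(1 <= i < m.+1) GTtop m i = \sum_(1 <= i < m.+1) a i.
  by move=> mn; rewrite !big_nat; apply: eq_bigr => i im; rewrite GTtopE.
rewrite /coef_h; case: k => [|k] in kn *; first by lia.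
rewrite /= !row_sum; [|lia..].
rewrite ![\sum_(1 <= i < k.+3) _]big_nat_recr // ![\sum_(1 <= i < k.+2) _]big_nat_recr //=.
by ring.
Qed.

Lemma column_top (r : C -> C -> Prop) v k i : (forall x, r x x) ->
  (forall y x z, r x y -> r y z -> r x z) -> (i <= k <= n.+1)%N ->
  (forall l, (i <= l <= n)%N -> r (v l i) (v l.+1 i)) -> r (v k i) (v n.+1 i).
Proof.
move=> r_refl r_trans ik r_next.
suff down d : (k + d <= n.+1)%N -> r (v k i) (v (k + d)%N i).
  by have := down (n.+1 - k)%N; rewrite subnKC; [apply|]; lia.
elim: d => [|d IHd] kd; first by rewrite addn0.
by rewrite addnS; apply: r_trans (IHd _) (r_next _ _); lia.
Qed.

Lemma aligned_top v : GTpattern v -> aligned n.+1 v -> v = GTtop.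
Proof.
move=> [out top _ _] al; apply: funext => k; apply: funext => i; rewrite /GTtop.
case: ifPn => [/and3P[i1 ik kn]|/out //]; rewrite -top; last by lia.
apply: (@column_top eq) => [//|y x z -> //||l il]; first by lia.
by apply: al; lia.
Qed.

Lemma GTpattern_natle_top v k i : GTpattern v -> (1 <= i <= k)%N -> (k <= n.+1)%N ->
  natle (v k i) (a i).
Proof.
move=> [_ top vert _] ik kn; rewrite -top; last by lia.
apply: column_top; [exact: natle_refl|exact: natle_trans|lia|move=> l il].
by apply: vert; lia.
Qed.

Lemma GTe_singular_supp phi : (forall v, phi v <> 0 -> GTpattern v) ->
  (forall k, (1 <= k <= n)%N -> GTe k phi = 0) -> forall v, phi v <> 0 -> v = GTtop.
Proof.
move=> phi_supp sing v phiv.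
suff al m : (m <= n.+1)%N -> forall u, phi u <> 0 -> aligned m u.
  by apply: aligned_top; [apply: phi_supp|apply: (al n.+1)].
elim: m => [|m IHm] mn u phiu k i ik km; first by [].
have al := IHm (ltnW mn).
have [km'|/eqP km'] := eqVneq k m; last by apply: al => //; lia.
rewrite {}km' {k km} in ik *; apply: contrapT => ne.
have Pu := phi_supp u phiu.
have Pw : GTpattern (arr_add u (delta R m i)) by apply: aligned_add => //; apply: al.
have /(congr1 (fun psi => psi (arr_add u (delta R m i)))) : GTe m phi = 0 by apply: sing; lia.
rewrite GTeE (bigD1_seq i) /= ?mem_index_iota ?iota_uniq //.
rewrite [X in _ + X]big1_seq ?addr0; last first.
  move=> j /andP[ji]; rewrite mem_index_iota => jm.
  rewrite /GTe_term /pattern_shift on_patternsT // /on_patterns.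
  case: asboolP => _; rewrite ?mulr0 //.
  rewrite [X in _ * X](_ : _ = 0) ?mulr0 //; apply: contrapT => phi_neq0.
  by apply: (aligned_swap (al _ phiu) ik jm _ (al _ phi_neq0)); rewrite eq_sym.
rewrite /GTe_term /pattern_shift on_patternsT // arr_addK on_patternsT // => /eqP.
rewrite mulf_eq0 oppr_eq0 (negbTE (coef_e_neq0 Pu _ _ ne)) //=.
by move=> /eqP.
Qed.

Definition height v : C := \sum_(1 <= k < n.+1) \sum_(1 <= i < k.+1) (a i - v k i).

Lemma height_add v k i : (1 <= i <= k)%N -> (k <= n)%N ->
  height (arr_add v (delta R k i)) = height v - 1.
Proof.
move=> ik kn; rewrite /height.
transitivity (\sum_(1 <= k' < n.+1) (\sum_(1 <= i' < k'.+1) (a i' - v k' i')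
   - \sum_(1 <= i' < k'.+1) delta R k i k' i')).
  apply: eq_bigr => k' _; rewrite -sumrB; apply: eq_bigr => i' _.
  by rewrite /arr_add opprD addrA.
rewrite sumrB; congr (_ - _).
rewrite (bigD1_seq k) /= ?mem_index_iota ?iota_uniq //; last by lia.
rewrite (bigD1_seq i) /= ?mem_index_iota ?iota_uniq // /delta !eqxx.
by rewrite !big1 ?addr0 // => [k' /negbTE kk'|i' /negbTE -> //]; rewrite big1 ?kk'.
Qed.

Lemma height_nat v : GTpattern v -> exists t : nat, height v = t%:R.
Proof.
move=> Pv; suff [t ->] : natle 0 (height v) by exists t; rewrite add0r.
have natle0D (x y : C) : natle 0 x -> natle 0 y -> natle 0 (x + y).
  by move=> [s ->] [t ->]; exists (s + t)%N; rewrite natrD !add0r.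
rewrite /height big_nat; apply: (big_ind (natle 0)) => // [|k kn]; first exact: natle_refl.
rewrite big_nat; apply: (big_ind (natle 0)) => // [|i ik]; first exact: natle_refl.
have [||t ->] := @GTpattern_natle_top v k i Pv; [lia|lia|].
by exists t; rewrite addrAC subrr.
Qed.

Lemma height_add_nat v k i (s t : nat) : (1 <= i <= k)%N -> (k <= n)%N ->
  height v = s%:R -> height (arr_add v (delta R k i)) = t%:R -> s = t.+1.
Proof.
move=> ik kn hs; rewrite height_add // hs => /eqP.
by rewrite subr_eq natr1 eqr_nat => /eqP.
Qed.

Definition height_bounded (L : nat) phi : Prop := forall v, phi v <> 0 ->
  GTpattern v /\ exists2 t : nat, (t < L)%N & height v = t%:R.

Lemma GTe_height_bounded L phi k : (1 <= k <= n)%N ->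
  height_bounded L.+1 phi -> height_bounded L (GTe k phi).
Proof.
move=> kn phiL w GTew.
have [i ik [Pw phi_i]] : exists2 i, (1 <= i <= k)%N &
    GTpattern w /\ phi (arr_sub w (delta R k i)) <> 0.
  apply: contrapT => none; apply: GTew.
  rewrite GTeE big_nat big1 // => i ik; rewrite /GTe_term /pattern_shift /on_patterns.
  case: asboolP => // Pw; case: asboolP => [_|]; rewrite ?mulr0 //.
  rewrite [phi _](_ : _ = 0) ?mulr0 //; apply: contrapT => phi_i.
  by apply: none; exists i.
have [_ [t tL ht]] := phiL _ phi_i; have [s hs] := height_nat Pw.
split=> //; exists s => //; rewrite -ltnS; move: tL.
by rewrite (@height_add_nat (arr_sub w (delta R k i)) k i t s) ?arr_subK //; lia.
Qed.

Lemma height_bounded_subspace : subspace (fun phi => exists L, height_bounded L phi).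
Proof.
split=> [|c psi psi' [L psiL] [L' psiL']]; first by exists 0%N.
exists (maxn L L') => v; have [psi0|/psiL[Pv [t tL ht]] _] := pselect (psi v = 0).
  rewrite addrfctE scalefctE psi0 mulr0 add0r => /psiL'[Pv [t tL ht]].
  by split=> //; exists t; rewrite // leq_max tL orbT.
by split=> //; exists t; rewrite // leq_max tL.
Qed.

Lemma GTspan_height_bounded phi : GTspan n a phi -> exists L, height_bounded L phi.
Proof.
move=> [s ->]; apply: (subspace_sum height_bounded_subspace) => p _ _.
have [Pp|nPp] := pselect (GTpattern p.2); last first.
  by exists 0%N => v; rewrite GTbasis_out // scaler0.
have [t ht] := height_nat Pp; exists t.+1 => v basis_v.
have /GTbasis_neq0[_ ->] : GTbasis p.2 v <> 0.
  by move=> b0; apply: basis_v; rewrite scalefctE b0 mulr0.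
by split=> //; exists t.
Qed.

Hypothesis a_regular : forall i j, (1 <= i < j)%N -> (j <= n.+1)%N -> ~ natle (a i) (a j).

Lemma GTpattern_top : GTpattern GTtop.
Proof.
split=> [k i /negbTE out|i i_n|k i ik kn|k i j ik kn ij].
- by rewrite /GTtop out.
- by rewrite GTtopE.
- by rewrite !GTtopE //; [exact: natle_refl|lia..].
- by rewrite !GTtopE //; [apply: a_regular; lia|lia..].
Qed.

Lemma GTtop_add k i : (1 <= i <= k)%N -> (k <= n)%N -> ~ GTpattern (arr_add GTtop (delta R k i)).
Proof.
move=> ik kn /(GTpattern_addP GTpattern_top ik kn)[ne _]; apply: ne.
by rewrite !GTtopE //; lia.
Qed.

Lemma GTe_top k : (1 <= k <= n)%N -> GTe k (GTbasis GTtop) = 0.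
Proof.
move=> kn; rewrite GTe_basis; last exact: GTpattern_top.
rewrite big_nat big1 // => i ik.
by rewrite GTbasis_out ?scaler0 //; apply: GTtop_add; lia.
Qed.

Lemma GTf_at_top k phi : (1 <= k <= n)%N -> GTf k phi GTtop = 0.
Proof.
move=> kn; rewrite GTfE big_nat big1 // => i ik.
rewrite /GTf_term /pattern_shift on_patternsT; last exact: GTpattern_top.
by rewrite on_patternsF ?mulr0 //; apply: GTtop_add; lia.
Qed.

(* Raising operators lower the height, so they bring any nonzero vector to a nonzero
   singular one. *)
Lemma GTe_reach_top (K : (arr R -> C^o) -> Prop) : subspace K ->
  (forall k phi, (1 <= k <= n)%N -> K phi -> K (GTe k phi)) ->
  forall L phi, height_bounded L phi -> K phi -> phi <> 0 -> K (GTbasis GTtop).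
Proof.
move=> K_sub K_GTe; elim=> [|L IHL] phi phiL Kphi phi_neq0.
  by case: phi_neq0; apply: funext => v; apply: contrapT => /phiL[_ []].
have [[k kn GTek]|sing] := pselect (exists2 k, (1 <= k <= n)%N & GTe k phi <> 0).
  by apply: (IHL (GTe k phi)) GTek; [apply: GTe_height_bounded|apply: K_GTe].
have phi_top : forall v, phi v <> 0 -> v = GTtop.
  apply: GTe_singular_supp => [v /phiL[]//|k kn]; apply: contrapT => GTek.
  by apply: sing; exists k.
have phiE : phi = phi GTtop *: GTbasis GTtop.
  apply: funext => v; rewrite scalefctE GTbasisE; last exact: GTpattern_top.
  case: asboolP => [->|ne]; first by rewrite mulr1.
  by rewrite mulr0; apply: contrapT => /phi_top.
have c_neq0 : phi GTtop != 0.
  by apply/eqP => c0; apply: phi_neq0; rewrite phiE c0 scale0r.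
by rewrite -[GTbasis _](scalerK c_neq0) -phiE; apply: subspaceZ.
Qed.

Lemma GTbasis_aligned m u i : GTpattern u -> aligned m u -> (1 <= i <= m)%N -> (m <= n)%N ->
  u m i <> u m.+1 i -> let v := arr_add u (delta R m i) in
  GTbasis u = (coef_f v m i)^-1 *: (GTf m (GTbasis v)
    - \sum_(1 <= j < m.+1 | j != i) coef_f v m j *: GTbasis (arr_sub v (delta R m j))).
Proof.
move=> Pu al im mn ne v; have Pv : GTpattern v by apply: aligned_add.
have uE : u = arr_sub v (delta R m i) by rewrite arr_addK.
have c_neq0 : coef_f v m i != 0 by apply: (coef_f_neq0 Pv) => //; rewrite -uE.
rewrite GTf_basis // (bigD1_seq i) /= ?mem_index_iota ?iota_uniq //.
by rewrite -uE addrK scalerK.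
Qed.

Section Generation.
Variable G : (arr R -> C^o) -> Prop.
Hypotheses (G_sub : subspace G) (G_top : G (GTbasis GTtop)).
Hypothesis G_GTf : forall k phi, (1 <= k <= n)%N -> G phi -> G (GTf k phi).

Lemma gen_GTbasis_height (t : nat) :
  (forall s u, (s < t)%N -> GTpattern u -> height u = s%:R -> G (GTbasis u)) ->
  forall m u, (m <= n.+1)%N -> GTpattern u -> height u = t%:R -> ~ aligned m u ->
  G (GTbasis u).
Proof.
move=> below; elim=> [|m IHm] u mn Pu hu nal; first by case: nal.
have [al|] := pselect (aligned m u); last exact: IHm (ltnW mn) Pu hu.
have [i im ne] : exists2 i, (1 <= i <= m)%N & u m i <> u m.+1 i.
  apply: contrapT => none; apply: nal => k i ik; rewrite ltnS leq_eqVlt => /predU1P[km|].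
    by apply: contrapT => ne; apply: none; exists i; rewrite -km.
  exact: al.
rewrite (GTbasis_aligned Pu al im mn ne); set v := arr_add u _.
have Pv : GTpattern v by apply: aligned_add.
apply/(subspaceZ G_sub)/(subspaceB G_sub).
  apply: G_GTf; first by lia.
  have [s hs] := height_nat Pv; apply: below Pv (hs).
  by rewrite (height_add_nat im mn hu hs).
apply: (subspace_sum G_sub) => j; rewrite mem_index_iota => jm ji.
apply: (subspaceZ G_sub); set w := arr_sub v _.
have [Pw|nPw] := pselect (GTpattern w); last by rewrite GTbasis_out //; apply: G_sub.1.
apply: (IHm w (ltnW mn) Pw); last by apply: aligned_swap => //; rewrite eq_sym.
by have := height_add w jm mn; rewrite arr_subK /v height_add // hu => /addIr.
Qed.

Lemma gen_GTbasis u : G (GTbasis u).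
Proof.
have [Pu|nPu] := pselect (GTpattern u); last by rewrite GTbasis_out //; apply: G_sub.1.
have [t hu] := height_nat Pu; elim/ltn_ind: t u Pu hu => t IHt u Pu hu.
have [/(aligned_top Pu) -> //|nal] := pselect (aligned n.+1 u).
apply: (gen_GTbasis_height _ (leqnn _) Pu hu nal) => s u' st Pu' hu'.
exact: IHt st u' Pu' hu'.
Qed.

End Generation.
End GTIrreducibility.

Section HighestWeightGT.
Variables (R : realType) (n : nat).
Local Notation C := R[i].
Local Notation M := 'M[C]_(n.+1).
Variables (V : lmodType C) (rho : M -> V -> V) (lam : M -> C) (v0 : V).
Hypotheses (gm : is_gmod rho) (simple : simple_gmod rho) (hw : hw_vector rho id lam v0).
Variable a : nat -> C.
Hypothesis a_regular : forall i j, (1 <= i < j)%N -> (j <= n.+1)%N -> ~ natle (a i) (a j).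
Hypothesis lam_h : forall k, (1 <= k <= n)%N -> lam (gt_h R n k) = a k - a k.+1 - 1.

Local Notation top := (GTtop n a).
Local Notation GTbasis := (GTbasis n a).
Local Notation GTcyclic := (lowering_span n (GTf n a) (GTbasis top)).

Lemma GTcyclic_basis u : GTcyclic (GTbasis u).
Proof.
apply: gen_GTbasis => //; first exact: lowering_span_subspace.
  exact: lowering_span_gen.
by move=> k phi; apply: lowering_span_F.
Qed.

Lemma GTcyclic_span phi : GTcyclic phi -> GTspan n a phi.
Proof.
elim=> [|c psi psi' _ ? _ ?|k psi _ _]; first exact: GTspan_basis.
  exact: (GTspan_subspace n a).2.
exact: GTspan_GTf.
Qed.

Lemma GTcyclic_cocyclic (K : (arr R -> C^o) -> Prop) : subspace K ->
  (forall k phi, (1 <= k <= n)%N -> K phi -> K (GTe n a k phi)) ->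
  (forall phi, K phi -> GTcyclic phi) ->
  forall phi, K phi -> phi <> 0 -> K (GTbasis top).
Proof.
move=> K_sub K_GTe K_cyclic phi Kphi.
have [L phiL] := GTspan_height_bounded (GTcyclic_span (K_cyclic _ Kphi)).
exact: (GTe_reach_top a_regular K_sub K_GTe phiL Kphi).
Qed.

Lemma highest_weight_GT_iso : exists j : (arr R -> C^o) -> V,
  module_iso_on rho (GTe n a) (GTf n a) (GTh n a) (GTbasis top) j.
Proof.
have Ptop := GTpattern_top a_regular.
have GTh_top k : (1 <= k <= n)%N -> GTh n a k (GTbasis top) = lam (gt_h R n k) *: GTbasis top.
  by move=> kn; rewrite GTh_basis // coef_h_top // lam_h.
apply: (highest_weight_iso gm simple hw (GT_chevalley_rel n a) (GTe_top a_regular) GTh_top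
  (pr := fun phi => phi top)) => //.
- by rewrite GTbasisE // asboolT.
- by move=> k phi; apply: GTf_at_top.
- exact: GTcyclic_cocyclic.
Qed.

Lemma highest_weight_strongly_tame : strongly_tame_GT rho.
Proof.
have [j [j_lin j_inj j_surj j_gen]] := highest_weight_GT_iso.
have cyclic_sub := lowering_span_subspace n (GTf n a) (GTbasis top).
have j_sum := linear_on_sum cyclic_sub j_lin.
have j0 : j 0 = 0 by have := j_sum _ [::] (fun=> 0) GTbasis GTcyclic_basis; rewrite !big_nil.
exists (GTpattern n a), (j \o GTbasis); split=> [w [out _ _ _] k i|w nPw|m w c w_inj Pw sum0|x|].
- exact: out.
- by rewrite /= GTbasis_out.
- apply: GTbasis_free w_inj Pw _; apply: j_inj.
    by apply: (subspace_sum cyclic_sub) => l _ _; apply/(subspaceZ cyclic_sub)/GTcyclic_basis.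
  by rewrite j_sum // => l; apply: GTcyclic_basis.
- have [phi /GTcyclic_span/GTspan_patterns[m [w [c [Pw ->]]]] <-] := j_surj x.
  by exists m, w, c; split=> //; rewrite j_sum // => l; apply: GTcyclic_basis.
- move=> k kn v Pv; have [je jf jh] := j_gen k _ kn (GTcyclic_basis v).
  rewrite /= -je -jf -jh GTe_basis // GTf_basis // GTh_basis //; split.
  + rewrite j_sum => [|i]; last exact: GTcyclic_basis.
    by rewrite -sumrN; apply: eq_bigr => i _; rewrite scaleNr.
  + by rewrite j_sum // => i; apply: GTcyclic_basis.
  + have := j_lin (coef_h v k) _ _ (GTcyclic_basis v) cyclic_sub.1.
    by rewrite j0 !addr0.
Qed.

End HighestWeightGT.

(** * Automorphisms *)

Section Automorphisms.
Variables (R : realType) (n : nat).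
Local Notation C := R[i].
Local Notation M := 'M[C]_(n.+1).
Implicit Types (u ui : M -> M) (x y g : M).

Definition lie_automorphism u ui : Prop :=
  [/\ linear u, forall x y, u (lie x y) = lie (u x) (u y),
      forall x, sl x -> sl (u x), forall x, sl x -> sl (ui x)
    & cancel ui u].

Lemma lie_automorphism_comp u ui w wi : lie_automorphism u ui -> lie_automorphism w wi ->
  lie_automorphism (u \o w) (wi \o ui).
Proof.
move=> [u_lin u_lie u_sl ui_sl uK] [w_lin w_lie w_sl wi_sl wK].
split=> /= [c x y|x y|x /w_sl/u_sl|x /ui_sl/wi_sl|x] //.
- by rewrite /= w_lin u_lin.
- by rewrite w_lie u_lie.
- by rewrite /= wK uK.
Qed.

Lemma lie_automorphism_conj g gi : g *m gi = 1%:M ->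
  lie_automorphism (fun y => g *m y *m gi) (fun y => gi *m y *m g).
Proof.
move=> ggi; have gig := mulmx1C ggi.
have conjM x y : (g *m x *m gi) *m (g *m y *m gi) = g *m (x *m y) *m gi.
  by rewrite !mulmxA -(mulmxA (g *m x)) gig mulmx1.
split=> [c x y|x y|x sx|x sx|x].
- by rewrite mulmxDr mulmxDl -scalemxAr -scalemxAl.
- by rewrite /lie !conjM mulmxBr mulmxBl.
- by rewrite /sl -mulmxA mxtrace_mulC -mulmxA gig mulmx1.
- by rewrite /sl -mulmxA mxtrace_mulC -mulmxA ggi mulmx1.
- by rewrite !mulmxA ggi mul1mx -mulmxA ggi mulmx1.
Qed.

Lemma lie_automorphism_opp_tr :
  lie_automorphism (fun x : M => - x^T) (fun x : M => - x^T).
Proof.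
have sl_opp_tr (x : M) : sl x -> sl (- x^T).
  by rewrite /sl raddfN /= mxtrace_tr => ->; rewrite oppr0.
split=> [c x y|x y|//|//|x].
- by rewrite linearP opprD scalerN.
- by rewrite /lie raddfB /= !trmx_mul opprB !mulNmx ![_ *m - _]mulmxN !opprK.
- by rewrite linearN /= trmxK opprK.
Qed.

Lemma expadE x y : (1 <= n)%N -> x *m x = 0 ->
  expad x y = (1%:M + x) *m y *m (1%:M - x).
Proof.
move=> n1 xx; rewrite /expad.
have lie2 z : lie x (lie x z) = - (2 *: (x *m z *m x)).
  rewrite /lie mulmxBr mulmxBl !mulmxA xx mul0mx sub0r -[z *m x *m x]mulmxA xx mulmx0.
  by rewrite subr0 scaler_nat mulr2n opprD.
have lie3 z : lie x (lie x (lie x z)) = 0.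
  rewrite lie2 /lie mulmxBr mulmxBl !mulmxA xx !mul0mx -[_ *m x *m x]mulmxA xx mulmx0.
  by rewrite subrr scaler0 oppr0.
have -> : (2 * n).+2 = (2 * n).-1.+3 by lia.
rewrite !big_ord_recl big1 => [|i _] /=; last by rewrite lie3 scaler0.
rewrite !fact0 invr1 !scale1r addr0 lie2 scalerN scalerA mulVf ?pnatr_eq0 // scale1r.
by rewrite mulmxDl mul1mx mulmxBr mulmx1 mulmxDl /lie opprD -!addrA.
Qed.

Lemma lie_automorphism_expad x : (1 <= n)%N -> x *m x = 0 ->
  lie_automorphism (expad x) (expad (- x)).
Proof.
move=> n1 xx.
have -> : expad x = (fun y => (1%:M + x) *m y *m (1%:M - x)).
  by apply: funext => y; apply: expadE.
have -> : expad (- x) = (fun y => (1%:M - x) *m y *m (1%:M + x)).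
  by apply: funext => y; rewrite expadE ?opprK // mulmxN mulNmx opprK.
by apply: lie_automorphism_conj; rewrite mulmxBr mulmx1 mulmxDl mul1mx xx addr0 addrK.
Qed.

Lemma lie_automorphism_expad3 x y : (1 <= n)%N -> x *m x = 0 -> y *m y = 0 ->
  lie_automorphism (expad x \o expad (- y) \o expad x)
                   (expad (- x) \o expad y \o expad (- x)).
Proof.
move=> n1 xx yy; have exp_x := lie_automorphism_expad n1 xx.
have exp_y : lie_automorphism (expad (- y)) (expad y).
  by rewrite -{2}[y]opprK; apply: lie_automorphism_expad; rewrite // mulmxN mulNmx opprK.
exact: lie_automorphism_comp (lie_automorphism_comp exp_x exp_y) exp_x.
Qed.

Lemma gt_e_sqr k : (1 <= k <= n)%N -> gt_e R n k *m gt_e R n k = 0.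
Proof.
move=> kn; rewrite EuM; last by lia.
by rewrite (_ : (_ == _) = false) ?scale0r //; lia.
Qed.

Lemma gt_f_sqr k : (1 <= k <= n)%N -> gt_f R n k *m gt_f R n k = 0.
Proof.
move=> kn; rewrite EuM; last by lia.
by rewrite (_ : (_ == _) = false) ?scale0r //; lia.
Qed.

Lemma lie_automorphism_rW k : (1 <= k <= n)%N -> lie_automorphism (@rW R n k) (rWinv k).
Proof.
by move=> kn; apply: lie_automorphism_expad3; [lia|apply: gt_f_sqr|apply: gt_e_sqr].
Qed.

Lemma lie_automorphism_rWinv k : (1 <= k <= n)%N -> lie_automorphism (@rWinv R n k) (rW k).
Proof.
move=> kn; have sqrN x : x *m x = 0 -> - x *m - x = 0 by rewrite mulmxN mulNmx opprK.
have := @lie_automorphism_expad3 (- gt_f R n k) (- gt_e R n k); rewrite !opprK.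
by apply; [lia|apply/sqrN/gt_f_sqr|apply/sqrN/gt_e_sqr].
Qed.

Local Notation J := (Jmx R n).

Lemma Jmx_trmx : J^T = (-1) ^+ n *: J.
Proof.
apply/matrixP => a b; rewrite !mxE addnC.
case: eqP => [e|_]; last by rewrite mulr0.
rewrite -exprD -signr_odd -[RHS]signr_odd; congr (_ ^+ nat_of_bool _).
by move/(congr1 odd): e; rewrite !oddD !oddS => <-; do 2 case: odd.
Qed.

Lemma Jmx_orthogonal : J *m J^T = 1%:M.
Proof.
apply/matrixP => a b; rewrite !mxE (bigD1 (rev_ord a)) //= big1 ?addr0.
  rewrite !mxE /= (_ : (a + (n.+1 - a.+1) == n)%N); last by have := ltn_ord a; lia.
  rewrite (_ : (b + (n.+1 - a.+1) == n)%N = (a == b)); last first.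
    by rewrite -val_eqE /=; have := ltn_ord a; have := ltn_ord b; lia.
  by case: eqP => [->|_]; rewrite ?mulr0 // -expr2 sqrr_sign.
move=> c ca; rewrite !mxE (_ : (a + c == n)%N = false) ?mul0r //.
apply: contraNF ca => /eqP e; rewrite -val_eqE /=; apply/eqP.
by have := ltn_ord a; lia.
Qed.

Lemma lie_automorphism_sigmaW : lie_automorphism (@sigmaW R n) (@sigmaW R n).
Proof.
have := lie_automorphism_comp (lie_automorphism_conj Jmx_orthogonal) lie_automorphism_opp_tr.
congr lie_automorphism; apply: funext => x /=; first by rewrite mulmxN mulNmx.
rewrite /sigmaW !trmx_mul trmxK {1}Jmx_trmx mulmxA -scalemxAl; congr (- _).
by rewrite -scalemxAl [in RHS]Jmx_trmx -scalemxAr.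
Qed.

Lemma Wbar_automorphism u ui : Wbar u ui -> lie_automorphism u ui.
Proof.
elim=> [|w wi k kn _ IH|w wi k kn _ IH|w wi _ IH]; first by split.
- exact: (lie_automorphism_comp IH (lie_automorphism_rW kn)).
- exact: (lie_automorphism_comp IH (lie_automorphism_rWinv kn)).
- exact: (lie_automorphism_comp IH lie_automorphism_sigmaW).
Qed.

Section Twist.
Variables (V : lmodType C) (rho : M -> V -> V) (u ui : M -> M).
Hypothesis aut : lie_automorphism u ui.

Lemma gmod_twist : is_gmod rho -> is_gmod (twist_by_inv rho u).
Proof.
have [u_lin u_lie u_sl _ _] := aut; move=> [rho_lin rho_linl rho_lie]; rewrite /twist_by_inv.
split=> [x c v w|x y c v sx sy|x y v sx sy]; first exact: rho_lin.
- by rewrite u_lin rho_linl //; apply: u_sl.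
- by rewrite u_lie rho_lie //; apply: u_sl.
Qed.

Lemma simple_twist : simple_gmod rho -> simple_gmod (twist_by_inv rho u).
Proof.
have [_ _ _ ui_sl uK] := aut; move=> [nz simple]; split=> // U [U0 UD UZ Urho].
apply: simple; split=> // x v sx Uv; rewrite -[x]uK.
by apply: (Urho (ui x)) => //; apply: ui_sl.
Qed.

End Twist.
End Automorphisms.

(** * Admissible weights *)

Section AdmissibleWeights.
Variables (R : realType) (n p q : nat).
Local Notation C := R[i].
Implicit Types (mu : 'I_n -> nat) (eta : 'I_n -> int) (a b : 'I_n.+1).

Lemma epsc_diff (c : 'I_n -> C) a b : (a < b)%N ->
  epsc c a - epsc c b = \sum_(i < n | (a <= i < b)%N) c i.
Proof.
move=> ab; rewrite /epsc (bigID (fun i : 'I_n => (i < b)%N)) /=.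
rewrite [X in _ + X - _](eq_bigl (fun i : 'I_n => (b <= i)%N)) ?addrK // => i.
by rewrite -leqNgt; case: (leqP b i) => bi; rewrite ?andbF ?andbT //; lia.
Qed.

Definition shifted_weight mu eta b : C :=
  epsc (fun i => (mu i)%:R) b - (p%:R / q%:R) * epsc (fun i => (eta i)%:~R) b
  + rho_eps R b.

Lemma shifted_weight_diff mu eta a b : (a < b)%N ->
  shifted_weight mu eta a - shifted_weight mu eta b =
  (\sum_(i < n | (a <= i < b)%N) mu i + (b - a))%N%:R
    - (p%:R / q%:R) * (\sum_(i < n | (a <= i < b)%N) eta i)%:~R.
Proof.
move=> ab; rewrite natrD natr_sum rmorph_sum /= -!epsc_diff // /shifted_weight /rho_eps.
have -> : (n - a)%N = (n - b + (b - a))%N by have := ltn_ord b; lia.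
by rewrite natrD; ring.
Qed.

Hypotheses (q_gt0 : (0 < q)%N) (pq_coprime : coprime p q).

Lemma integral_difference (X : nat) (s t : int) :
  X%:R - (p%:R / q%:R) * s%:~R = t%:~R :> C ->
  exists2 m : int, s = m * q%:Z & X%:Z - t = p%:Z * m.
Proof.
move=> e; have q_neq0 : q%:R != 0 :> C by rewrite pnatr_eq0; lia.
have {}e : (X%:Z - t) * q%:Z = p%:Z * s.
  apply: (@intr_inj C); rewrite !rmorphM rmorphB /= -e.
  by rewrite /= !pmulrn; field.
have : (q%:Z %| p%:Z * s)%Z by rewrite -e dvdz_mull.
rewrite Gauss_dvdzr => [/dvdzP[m sE]|]; last by rewrite coprimezE /= coprime_sym.
exists m => //; apply: (@mulIf _ q%:Z); first by lia.
by rewrite e sE mulrA.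
Qed.

(* An integral difference forces q to divide (eta, alpha), hence (eta, alpha) = 0 or q; the
   bound on mu then determines its sign. *)
Lemma shifted_weight_regular mu eta (w : 'S_n.+1) : (n.+1 <= p)%N ->
  (\sum_i mu i <= p - n.+1)%N -> Ccond q w eta ->
  forall i j : 'I_n.+1, (i < j)%N ->
  ~ natle (shifted_weight mu eta ((w^-1)%g i)) (shifted_weight mu eta ((w^-1)%g j)).
Proof.
move=> np mu_le Cw i j ij [t e].
have mu_sub_le a b : (\sum_(i < n | (a <= i < b)%N) mu i <= p - n.+1)%N.
  apply: leq_trans mu_le; rewrite [leqRHS](bigID (fun i : 'I_n => (a <= i < b)%N)) /=.
  exact: leq_addr.
set a := (w^-1)%g i in e; set b := (w^-1)%g j in e.
have wa : w a = i by rewrite permKV.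
have wb : w b = j by rewrite permKV.
have := ltn_ord a; have := ltn_ord b => bn an.
case: (ltngtP a b) => [ab|ba|/ord_inj ab]; last by move: ij; rewrite -wa -wb ab ltnn.
- have := Cw a b ab; rewrite wa wb ij /=; set s := \sum_(_ < _ | _) _ => -[s_ge0 s_lt].
  have := shifted_weight_diff mu eta ab.
  rewrite e opprD addrA subrr sub0r -/s => /esym.
  rewrite -[t%:R]/(t%:Z%:~R) -mulrNz => /integral_difference[m sE tE].
  have m0 : m = 0 by nia.
  by move: tE; rewrite m0 mulr0; lia.
- have := Cw b a ba; rewrite wa wb ltnNge (ltnW ij) /=.
  set s := \sum_(_ < _ | _) _ => -[s_gt0 s_le].
  have := shifted_weight_diff mu eta ba.
  rewrite e addrAC subrr add0r -/s => /esym.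
  rewrite -[t%:R]/(t%:Z%:~R) => /integral_difference[m sE tE].
  have m1 : m = 1 by nia.
  by move: tE (mu_sub_le b a); rewrite m1 mulr1; lia.
Qed.

Lemma wt_val_gt_h (c : 'I_n.+1 -> C) k : (1 <= k <= n)%N ->
  wt_val c (gt_h R n k) = c (inord k.-1) - c (inord k).
Proof.
move=> kn; have val1 : (inord k.-1 : 'I_n.+1) = k.-1 :> nat by rewrite inordK //; lia.
have val2 : (inord k : 'I_n.+1) = k :> nat by rewrite inordK //; lia.
have sum_Eu m (i0 : 'I_n.+1) : i0 = m :> nat -> \sum_i c i * Eu R n m.+1 m.+1 i i = c i0.
  move=> <-; rewrite (bigD1 i0) //= mxE eqxx mulr1 big1 ?addr0 // => i ne.
  by rewrite mxE /= (negbTE (_ : (i : nat) != i0)) ?mulr0.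
rewrite /wt_val -(sum_Eu _ _ val1) -(sum_Eu _ _ val2) -sumrB; apply: eq_bigr => i _.
by rewrite -mulrBr prednK; [rewrite !mxE|lia].
Qed.

Lemma admissible_strongly_tame (lam : 'M[C]_n.+1 -> C) : (n.+1 <= p)%N -> in_Prbar p q lam ->
  forall (V : lmodType C) (rho : 'M[C]_n.+1 -> V -> V),
    is_gmod rho -> simple_gmod rho -> (exists v, hw_vector rho id lam v) ->
    strongly_tame_GT rho.
Proof.
move=> np [mu [w [eta [mu_le Cw lamE]]]] V rho gm simple [v0 hw].
pose a i : C := shifted_weight mu eta ((w^-1)%g (inord i.-1)).
apply: (highest_weight_strongly_tame gm simple hw (a := a)) => [i j ij jn|k kn].
  by apply: shifted_weight_regular; rewrite // !inordK; lia.
rewrite lamE; last exact: cartan_gt_h.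
rewrite wt_val_gt_h // /dot_act /wact /rho_eps !inordK; [|lia|lia].
rewrite /a /shifted_weight /rho_eps succnK (_ : (n - k.-1 = (n - k).+1)%N); last by lia.
by rewrite -[(n - k).+1%:R]natr1; ring.
Qed.

End AdmissibleWeights.

Theorem mainTheorem14 (R : realType) (n p q : nat) (lam : 'M[R[i]]_(n.+1) -> R[i]) :
  (1 <= n)%N -> (0 < q)%N -> coprime p q -> (n.+1 <= p)%N ->
  in_Prbar p q lam ->
  (forall (V : lmodType R[i]) (rho : 'M[R[i]]_(n.+1) -> V -> V),
      is_gmod rho -> simple_gmod rho -> (exists v, hw_vector rho id lam v) ->
      strongly_tame_GT rho) /\
  (forall (u ui : 'M[R[i]]_(n.+1) -> 'M[R[i]]_(n.+1)), Wbar u ui ->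
   forall (V : lmodType R[i]) (rho : 'M[R[i]]_(n.+1) -> V -> V),
      is_gmod rho -> simple_gmod rho -> (exists v, hw_vector rho u lam v) ->
      strongly_tame_GT_base rho ui).
Proof.
move=> _ q_gt0 pq_coprime np lamP.
have tame := admissible_strongly_tame q_gt0 pq_coprime np lamP.
split=> [|u ui Wu V rho gm simple hw]; first exact: tame.
have aut := Wbar_automorphism Wu.
exists u, ui; split=> //; apply: tame hw.
  exact: gmod_twist aut gm.
exact: simple_twist aut simple.
Qed.
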